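(* Let $a\in\mathbb{R}$, $\lambda\ge 0$, $\beta\in(0,1)$ and $p_{01},p_{11}\in(0,1]$, and assume $a^2(1-p_{01})<1$. Let $Q^{\beta},V^{\beta}$ be the functions associated with the original POMDP on $\mathbb{R}\times[0,1]$ and $\tilde{Q}^{\beta},\tilde{V}^{\beta}$ those associated with the folded POMDP on $\mathbb{R}_+\times[0,1]$, as described in the context. Then for all $e\in\mathbb{R}$, $b\in[0,1]$ and $u\in\{0,1\}$, $$Q^{\beta}(e,b;u)=\tilde{Q}^{\beta}(|e|,b;u),\qquad V^{\beta}(e,b)=\tilde{V}^{\beta}(|e|,b).$$
   Context: Let $\mathbb{R}_+=[0,\infty)$, $\varphi(z)=e^{-z^2/2}/\sqrt{2\pi}$ and $\mathcal{T}(b):=b\,p_{11}+(1-b)\,p_{01}$. Here $p_{01},p_{11}$ are the probabilities that a two-state Markov (Gilbert–Elliott) channel is in the good state $1$ at the next step, given that it is currently in the bad state $0$, respectively the good state $1$. Original POMDP: the state at time $t$ is $(e(t),b(t))\in\mathbb{R}\times[0,1]$ (estimation error and belief that the channel is good) and the action is $u(t)\in\{0,1\}$ ($1$ = transmit). From state $(e,b)$ the next state $(e_+,b_+)$ is distributed as follows, with $w\sim\mathcal{N}(0,1)$ independent of the past: - if $u=0$: $(e_+,b_+)=(ae+w,\mathcal{T}(b))$; - if $u=1$: with probability $b$, $(e_+,b_+)=(w,p_{11})$, and with probability $1-b$, $(e_+,b_+)=(ae+w,p_{01})$. Write $p(e_+,b_+\mid e,b;u)$ for the corresponding transition density. A policy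 $\phi$ chooses, at each time $t$, the action as a measurable function of the history of states (and past actions) up to time $t$. The optimal value function is $$V^{\beta}(e,b):=\min_{\phi}\mathbb{E}_{\phi}\Big(\sum_{t=0}^{\infty}\beta^{t}\big(e(t)^2+\lambda u(t)\big)\Big),\qquad (e(0),b(0))=(e,b),$$ and, with $w\sim\mathcal{N}(0,1)$, $$Q^{\beta}(e,b;0):=e^2+\beta\,\mathbb{E}\big[V^{\beta}(ae+w,\mathcal{T}(b))\big],$$ $$Q^{\beta}(e,b;1):=e^2+\lambda+\beta\,\mathbb{E}\big[b\,V^{\beta}(w,p_{11})+(1-b)\,V^{\beta}(ae+w,p_{01})\big].$$ Folded POMDP: state $(\tilde{e},\tilde{b})\in\mathbb{R}_+\times[0,1]$, action $\tilde{u}\in\{0,1\}$, instantaneous cost $\tilde{e}^2+\lambda\tilde{u}$, and transition density $$\tilde{p}(\tilde{e}_+,\tilde{b}_+\mid\tilde{e},\tilde{b};\tilde{u})=p(\tilde{e}_+,\tilde{b}_+\mid\tilde{e},\tilde{b};\tilde{u})+p(-\tilde{e}_+,\tilde{b}_+\mid\tilde{e},\tilde{b};\tilde{u}),\qquad \tilde{e}_+\in\mathbb{R}_+.$$ (That is, the next error is the absolute value of the next error of the original POMDP.) $\tilde{V}^{\beta}(\tilde{e},\tilde{b})$ is its optimal (minimal over policies) expected infinite-horizon $\beta$-discounted cost from initial state $(\tilde{e},\tilde{b})$, and $$\tilde{Q}^{\beta}(\tilde{e},\tilde{b};0):=\tilde{e}^2+\beta\int_{0}^{\infty}\big[\varphi(y-a\tilde{e})+\varphi(y+a\tilde{e})\big]\tilde{V}^{\beta}(y,\mathcal{T}(\tilde{b}))\,dy,$$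 $$\tilde{Q}^{\beta}(\tilde{e},\tilde{b};1):=\tilde{e}^2+\lambda+\beta\tilde{b}\int_0^\infty 2\varphi(y)\tilde{V}^{\beta}(y,p_{11})\,dy+\beta(1-\tilde{b})\int_0^\infty\big[\varphi(y-a\tilde{e})+\varphi(y+a\tilde{e})\big]\tilde{V}^{\beta}(y,p_{01})\,dy.$$ *)

(* Defs.v *)
(* MathComp-Analysis, over an arbitrary [R : realType]. *)
From HB Require Import structures.
From mathcomp Require Import all_boot all_order all_algebra.
From mathcomp Require Import all_classical all_reals all_analysis.

Set Implicit Arguments.
Unset Strict Implicit.
Unset Printing Implicit Defensive.

Import Order.TTheory GRing.Theory Num.Theory.
Import numFieldNormedType.Exports.

Local Open Scope classical_set_scope.
Local Open Scope ring_scope.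

Section DecisionProcess.
Context {R : realType} {dX : measure_display} {X : measurableType dX}.

(* A decision rule for time [t] sees the past state-action pairs
   (s_0, u_0), ..., (s_{t-1}, u_{t-1}) and the current state s_t. *)
Definition policy := forall t : nat, t.-tuple (X * bool) -> X -> bool.

Definition measurable_policy (phi : policy) :=
  forall t : nat, measurable_fun [set: (t.-tuple (X * bool) * X)%type]
    (fun h => phi t h.1 h.2).

(* [trans x u B] is the probability that the next state lies in [B] when action
   [u] is taken in state [x]; [cost x u] is the instantaneous cost. *)
Variables (trans : X -> bool -> set X -> \bar R) (cost : X -> bool -> R).

Section Process.
Context {dO : measure_display} {Omega : measurableType dO}.
Variables (P : probability Omega R) (S : nat -> Omega -> X)
  (U : nat -> Omega -> bool).

Definition past (t : nat) (omega : Omega) : t.-tuple (X * bool) :=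
  [tuple (S i omega, U i omega) | i < t].

(* Under [P], the state-action process ([S], [U]) starts at [x], is controlled
   by [phi], and the conditional law of the next state given the history is
   [trans (S t) (U t)].  The last clause is this conditional law in integrated
   form; [U t] need not appear in the event since it is a function of the
   history.  The law of ([S], [U]) is determined by [x] and [phi]. *)
Record controlled_process (phi : policy) (x : X) : Prop := ControlledProcess {
  process_measurable : forall t, measurable_fun setT (S t) ;
  process_init : forall omega, S 0%N omega = x ;
  process_action : forall t omega,
    U t omega = phi t (past t omega) (S t omega) ;
  process_next : forall t (A : set (t.-tuple (X * bool) * X)) (B : set X),
    measurable A -> measurable B ->
    P ([set omega | A (past t omega, S t omega)] `&` (S t.+1 @^-1` B)) =
    (\int[P]_(omega in [set omega | A (past t omega, S t omega)])
       trans (S t omega) (U t omega) B)%E }.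

Definition discounted_cost (beta : R) : \bar R :=
  (\int[P]_omega
     \sum_(0 <= t <oo) (beta ^+ t * cost (S t omega) (U t omega))%:E)%E.

End Process.

(* Optimal cost over all measurable policies.  All processes controlled by the
   same policy from the same initial state have the same expected cost, so the
   choice of the underlying probability space is immaterial. *)
Definition optimal_value (beta : R) (x : X) : \bar R :=
  ereal_inf [set J | exists phi : policy, measurable_policy phi /\
    exists (dO : measure_display) (Omega : measurableType dO)
           (P : probability Omega R) (S : nat -> Omega -> X)
           (U : nat -> Omega -> bool),
      controlled_process P S U phi x /\ J = discounted_cost P S U beta].

End DecisionProcess.

Section GilbertElliott.
Context {R : realType}.
Variables (a lambda beta p01 p11 : R).

Definition gauss (z : R) : R := expR (- (z ^+ 2) / 2) / Num.sqrt (2 * pi).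

Definition belief_step (b : R) : R := b * p11 + (1 - b) * p01.

(* States are pairs (error, belief), the same cost being used for both
   problems; the action [true] is to transmit.  The transition laws below are
   only meaningful for beliefs in [0, 1] and, in the folded case, for
   nonnegative errors; these sets of states are left with probability zero. *)
Definition stage_cost (s : R * R) (u : bool) : R := s.1 ^+ 2 + lambda * u%:R.

Local Notation N01 := (normal_prob (0 : R) 1).

Definition trans_orig (s : R * R) (u : bool) (B : set (R * R)) : \bar R :=
  let: (e, b) := s in
  (if u then
     b%:E * N01 [set w | B (w, p11)]
     + (1 - b)%:E * N01 [set w | B (a * e + w, p01)]%R
   else N01 [set w | B (a * e + w, belief_step b)]%R)%E.

(* Mass given to [B] by the law on R_+ x {b'} with error density
   y |-> p(y) + p(-y), where p is the density of the normal law N(m, 1). *)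
Definition folded_gauss (m b' : R) (B : set (R * R)) : \bar R :=
  (\int[lebesgue_measure]_(y in `[0%R, +oo[ `&` [set y | B (y, b')])
     (gauss (y - m) + gauss (- y - m))%:E)%E.

Definition trans_fold (s : R * R) (u : bool) (B : set (R * R)) : \bar R :=
  let: (e, b) := s in
  (if u then
     b%:E * folded_gauss 0 p11 B + (1 - b)%:E * folded_gauss (a * e) p01 B
   else folded_gauss (a * e) (belief_step b) B)%E.

Definition V_orig (e b : R) : \bar R :=
  optimal_value trans_orig stage_cost beta (e, b).

Definition V_fold (e b : R) : \bar R :=
  optimal_value trans_fold stage_cost beta (e, b).

Definition Q_orig (e b : R) (u : bool) : \bar R :=
  (if u then
     (e ^+ 2 + lambda)%:E
     + beta%:E * \int[N01]_w (b%:E * V_orig w p11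
                              + (1 - b)%:E * V_orig (a * e + w)%R p01)
   else
     (e ^+ 2)%:E + beta%:E * \int[N01]_w V_orig (a * e + w)%R (belief_step b))%E.

Definition Q_fold (e b : R) (u : bool) : \bar R :=
  (if u then
     (e ^+ 2 + lambda)%:E
     + (beta * b)%:E * \int[lebesgue_measure]_(y in `[0%R, +oo[)
         ((2 * gauss y)%:E * V_fold y p11)
     + (beta * (1 - b))%:E * \int[lebesgue_measure]_(y in `[0%R, +oo[)
         ((gauss (y - a * e) + gauss (y + a * e))%:E * V_fold y p01)
   else
     (e ^+ 2)%:E + beta%:E * \int[lebesgue_measure]_(y in `[0%R, +oo[)
       ((gauss (y - a * e) + gauss (y + a * e))%:E
        * V_fold y (belief_step b)))%E.

End GilbertElliott.

(* Main.v *)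
Require Import Defs.
From HB Require Import structures.
From mathcomp Require Import all_boot all_order all_algebra.
From mathcomp Require Import all_classical all_reals all_analysis.
From mathcomp Require Import measurable_realfun zify ring lra.

Set Implicit Arguments.
Unset Strict Implicit.
Unset Printing Implicit Defensive.

Import Order.TTheory GRing.Theory Num.Theory.
Import numFieldNormedType.Exports.
Local Open Scope classical_set_scope.
Local Open Scope ring_scope.

(** Both problems have an optimal value equal to the limit of value iteration
    started from 0.  No policy does better than the [n]-th iterate over [n] steps;
    conversely, since there are two actions, the limit solves Bellman's equation,
    and the stationary policy that is greedy for it costs at most the limit
    because stage costs are nonnegative.  The iterates of the two problems
    correspond under [(e, b) |-> (|e|, b)], since the Gaussian noise is symmetric,
    and so do the limits.

    The greedy policy needs a controlled process on some probability space.  It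
    lives on the unit interval with the uniform law: the numbers formed by the
    binary digits of even and of odd index of a uniform number are independent
    and uniform, so at each time the first one produces the noise and the second
    one is kept as the source of all later randomness.  Their joint distribution
    function minus the expected one satisfies a halving functional equation and
    is bounded, hence vanishes. *)

(** * Sets of full probability *)

Lemma measureI_full d (T : measurableType d) (R : realType)
    (P : probability T R) (A B : set T) :
  measurable A -> measurable B -> P B = 1%E -> P (A `&` B) = P A.
Proof.
move=> mA mB PB; rewrite [RHS](measureDI P mA mB).
rewrite [X in (X + _)%E](_ : _ = 0%E) ?add0e//.
apply/eqP; rewrite eq_le measure_ge0 andbT.
have <- : P (~` B) = 0%E by rewrite probability_setC// PB subee.
by rewrite le_measure ?inE//; [exact: measurableD|exact: measurableC].
Qed.

Lemma integral_full d (T : measurableType d) (R : realType)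
    (P : probability T R) (A : set T) (f : T -> \bar R) :
  measurable A -> P A = 1%E -> measurable_fun setT f -> (forall x, 0 <= f x)%E ->
  (\int[P]_(x in A) f x = \int[P]_x f x)%E.
Proof.
move=> mA PA mf f0; have PC : P (~` A) = 0%E.
  by rewrite probability_setC// PA subee.
rewrite [RHS](ge0_negligible_integral _ _ (N := ~` A)) ?setTD ?setCK//.
exact: measurableC.
Qed.

(** * Uniform numbers and their binary digits *)

Section halfline.
Context {R : realType}.
Notation RR := (measurableTypeR R).

Let halfline : set (set RR) := [set A | exists x : R, A = `]-oo, x]%classic].

Lemma halfline_generates : (@measurable _ RR) = <<s halfline >>.
Proof.
rewrite RGenOInfty.measurableE eqEsubset; split => A.
  apply: smallest_sub; first exact: smallest_sigma_algebra.
  move=> _ [x ->]; rewrite -setCitvl; apply: sigma_algebraC.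
  by apply: sub_sigma_algebra; exists x.
apply: smallest_sub; first exact: smallest_sigma_algebra.
move=> _ [x ->]; rewrite -setCitvr; apply: sigma_algebraC.
by apply: sub_sigma_algebra; exists x.
Qed.

Lemma eq_measure_halfline (m1 m2 : {measure set RR -> \bar R}) :
  (forall x, m1 `]-oo, x]%classic = m2 `]-oo, x]%classic) ->
  (forall x, m1 `]-oo, x]%classic < +oo)%E ->
  forall A, measurable A -> m1 A = m2 A.
Proof.
move=> m12 m1oo A mA.
apply: (measure_unique halfline (fun n => `]-oo, n%:R]%classic)) => //.
- exact: halfline_generates.
- move=> _ _ [x ->] [y ->]; exists (Num.min x y).
  by apply/seteqP; split=> z /=; rewrite !in_itv/= le_min => /andP.
- by move=> n; exists n%:R.
- rewrite -subTset => x _; exists (Num.truncn x).+1 => //=.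
  by rewrite in_itv/= ltW// truncnS_gt.
- by move=> _ [x ->].
Qed.

End halfline.

(** * The uniform law and its distribution function *)

Section uniform.
Context {R : realType}.
Notation RR := (measurableTypeR R).

Definition unif : probability RR R := uniform_prob (@ltr01 R).

Lemma unifE (A : set RR) : measurable A ->
  unif A = lebesgue_measure (A `&` `[0, 1]%classic).
Proof.
move=> mA; rewrite /unif/= /uniform_prob integral_uniform_pdf.
rewrite (eq_integral (cst 1%E)); last first.
  move=> x; rewrite inE/= => -[_]; rewrite /= in_itv/= /uniform_pdf => ->.
  by rewrite subr0 invr1.
by rewrite integral_cst ?mul1e//; exact: measurableI.
Qed.

(** The distribution function of [unif], needed on the whole line because the arguments [2 * x] and
    [2 * x - 1] of the halving equations leave [0, 1]. *)
Definition clamp (x : R) := Num.max 0 (Num.min x 1).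

Lemma unif_cdf x : unif `]-oo, x]%classic = (clamp x)%:E.
Proof.
rewrite unifE//.
have -> : `]-oo, x]%classic `&` `[0, 1]%classic = `[0, Num.min x 1]%classic.
  apply/seteqP; split=> z /=; rewrite !in_itv/= le_min.
    by move=> [-> /andP[-> ->]].
  by move=> /and3P[-> -> ->].
rewrite lebesgue_measure_itv/= lte_fin sube0 /clamp.
by case: ltP => //.
Qed.

Lemma unif_itvoo01 : unif `]0, 1[%classic = 1%E.
Proof.
rewrite unifE// setIidl; last by apply: subset_itvScc; rewrite bnd_simp.
by rewrite lebesgue_measure_itv/= lte_fin ltr01 sube0.
Qed.

Lemma unif_ext (A B : set RR) : measurable A -> measurable B ->
  (forall x, 0 < x < 1 -> A x <-> B x) -> unif A = unif B.
Proof.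
move=> mA mB AB.
rewrite -(measureI_full mA _ unif_itvoo01)// -(measureI_full mB _ unif_itvoo01)//.
congr (unif _); apply/seteqP.
by split=> x/= [Cx]; rewrite in_itv/= => x01; split => //; apply/AB.
Qed.

End uniform.

(** * Image laws *)

Section law.
Context d d' {T : measurableType d} {T' : measurableType d'} {R : realType}.
Variables (P : probability T R) (f : T -> T').
Hypothesis mf : measurable_fun setT f.

Let mfun_f : {mfun T >-> T'} := HB.pack f (isMeasurableFun.Build _ _ _ _ f mf).

Definition law : probability T' R := distribution P mfun_f.

Lemma ge0_integral_law (g : T' -> \bar R) :
  measurable_fun setT g -> (forall y, 0 <= g y)%E ->
  (\int[law]_y g y = \int[P]_x g (f x))%E.
Proof.
move=> mg g0; rewrite (ge0_integral_pushforward mf P) ?preimage_setT//.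
Qed.

End law.

(** Both sides are finite measures in [B], hence determined by half-lines. Allowing an event [E] and
    a weight [c] makes it possible to upgrade one coordinate of a joint law while the other is held
    fixed. *)
Lemma eq_law_halfline d (T : measurableType d) (R : realType)
    (P : probability T R) (E : set T) (f : T -> measurableTypeR R) (c : R)
    (Q : probability (measurableTypeR R) R) :
  measurable E -> measurable_fun setT f -> 0 <= c ->
  (forall s, P (E `&` f @^-1` `]-oo, s]) = (c%:E * Q `]-oo, s]%classic)%E) ->
  forall B, measurable B -> P (E `&` f @^-1` B) = (c%:E * Q B)%E.
Proof.
move=> mE mf c0 PQ B mB.
pose m1 := @measure_function_pushforward__canonical__measure_function_Measure
  _ _ _ _ _ (mrestr P mE) f mf.
have m1E A : m1 A = P (E `&` f @^-1` A) by rewrite setIC.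
rewrite -m1E; apply: (@eq_measure_halfline _ m1 (mscale (NngNum c0) Q)) => // x.
  exact: etrans (m1E _) (PQ x).
rewrite m1E; apply: le_lt_trans (ltry 1); apply: probability_le1.
apply: measurableI => //; rewrite -[X in measurable X]setTI.
exact: (mf measurableT _ (measurable_itv _)).
Qed.

(** * Splitting a uniform number into two independent ones *)

Section digits.
Context {R : realType}.
Notation RR := (measurableTypeR R).
Notation U := (@unif R).

Lemma clampE (x : R) : clamp x = if x <= 0 then 0 else if x <= 1 then x else 1.
Proof.
rewrite /clamp; case: (leP x 1) => x1; case: (leP x 0) => x0.
- by [].
- by [].
- by lra.
- by rewrite max_r.
Qed.

(** The uniform law is the even mixture of its images under [x / 2] and [(1 + x) / 2]; this is the
    same fact for its distribution function. *)
Lemma clamp_split (x : R) :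
  clamp x = 2^-1 * clamp (2 * x) + 2^-1 * clamp (2 * x - 1).
Proof. rewrite !clampE; case: (leP x 0) => ?; case: (leP x 1) => ?;
  case: (leP (2 * x) 0) => ?; case: (leP (2 * x) 1) => ?;
  case: (leP (2 * x - 1) 0) => ?; case: (leP (2 * x - 1) 1) => ?; lra. Qed.

Definition half_add (i x : R) : R := (i + x) / 2.

Lemma measurable_half_add i : measurable_fun (setT : set RR) (half_add i : RR -> RR).
Proof. by apply: measurable_funM => //; exact: measurable_funD. Qed.

Lemma unif_half (E : set RR) : measurable E ->
  U E = (2^-1%:E * U [set x | E (half_add 0 x)]
       + 2^-1%:E * U [set x | E (half_add 1 x)])%E.
Proof.
move=> mE.
have h0 : (0 <= 2^-1 :> R)%R by lra.
pose h := NngNum h0.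
pose m := measure_add (mscale h (law U (measurable_half_add 0)))
                      (mscale h (law U (measurable_half_add 1))).
have mm A : m A = (2^-1%:E * U [set x | A (half_add 0 x)]
       + 2^-1%:E * U [set x | A (half_add 1 x)])%E.
  by rewrite /m measure_addE.
have hl (i x : R) : [set x0 | `]-oo, x]%classic (half_add i x0)] =
    `]-oo, (2 * x - i)]%classic.
  by apply/seteqP; split=> z /=; rewrite !in_itv/= /half_add => ?; lra.
rewrite -mm; apply: eq_measure_halfline => // x; last first.
  exact: (le_lt_trans (probability_le1 U _) (ltry _)).
transitivity (clamp x)%:E; first exact: unif_cdf.
transitivity (m `]-oo, x]%classic); last by [].
by rewrite mm !hl !unif_cdf subr0 -!EFinM -EFinD [in LHS]clamp_split.
Qed.

Definition digit (x : R) : bool := 2^-1 <= x.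
Definition shift2 (x : R) : R := 2 * x - (digit x)%:R.

Lemma measurable_digit : measurable_fun (setT : set RR) (digit : RR -> bool).
Proof. exact: measurable_fun_ler. Qed.

Lemma measurable_shift2 : measurable_fun (setT : set RR) (shift2 : RR -> RR).
Proof.
apply: measurable_funB; first exact: measurable_funM.
rewrite (_ : (fun x => _) = fun x : RR => if digit x then 1 else 0 : R).
  by apply: measurable_fun_ifT => //; exact: measurable_digit.
by apply/funext => x; case: (digit x).
Qed.

(** By [unif_half] the first digit is a fair coin independent of the uniform number left after the
    shift. The family [G] lets the event on the rest depend on the digit. *)
Lemma unif_digit (G : bool -> set RR) : (forall i, measurable (G i)) ->
  U [set x | G (digit x) (shift2 x)] =
  (2^-1%:E * U (G false) + 2^-1%:E * U (G true))%E.
Proof.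
move=> mG.
have mE : measurable [set x : RR | G (digit x) (shift2 x)].
  have -> : [set x : RR | G (digit x) (shift2 x)] =
    (digit @^-1` [set true] `&` shift2 @^-1` G true) `|`
    (digit @^-1` [set false] `&` shift2 @^-1` G false).
    apply/seteqP; split=> x/=; case: (digit x).
    - by left.
    - by right.
    - by move=> [[]|[]].
    - by move=> [[]|[]].
  have md b : measurable ((digit : RR -> bool) @^-1` [set b]).
    by rewrite -[X in measurable X]setTI; exact: measurable_digit.
  have ms b : measurable ((shift2 : RR -> RR) @^-1` G b).
    by rewrite -[X in measurable X]setTI; exact: measurable_shift2.
  by apply: measurableU; exact: measurableI.
have mh i : measurable
    [set x : RR | [set x : RR | G (digit x) (shift2 x)] (half_add i x)].
  by rewrite -[X in measurable X]setTI; exact: measurable_half_add.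
(* The endpoints are discarded because at [x = 1] the number [half_add 0 x] is 1/2, whose first
   digit is 1. *)
rewrite unif_half//; congr (_ * _ + _ * _)%E; apply: unif_ext => // x /andP[x0 x1] /=.
  have dx : digit (half_add 0 x) = false by rewrite /digit /half_add; apply/negbTE; lra.
  have -> : shift2 (half_add 0 x) = x by rewrite /shift2 dx /half_add mulr0n; lra.
  by rewrite dx.
have dx : digit (half_add 1 x) = true by rewrite /digit /half_add; lra.
have -> : shift2 (half_add 1 x) = x by rewrite /shift2 dx /half_add mulr1n; lra.
by rewrite dx.
Qed.

(** The first [n] digits of even index, followed by zeros, read as a binary expansion; hence the
    increase in [n]. *)
Fixpoint evens_approx (n : nat) (x : R) : R :=
  if n is m.+1 then half_add (digit x)%:R (evens_approx m (shift2 (shift2 x)))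
  else 0.

Lemma evens_approx_ge0 n x : 0 <= evens_approx n x.
Proof.
elim: n x => //= n IH x; have := IH (shift2 (shift2 x)).
by rewrite /half_add; case: (digit x) => /= ?; lra.
Qed.

Lemma evens_approx_le1 n x : evens_approx n x <= 1.
Proof.
elim: n x => //= n IH x; have := IH (shift2 (shift2 x)).
by rewrite /half_add; case: (digit x) => /= ?; lra.
Qed.

Lemma evens_approx_nd x :
  {homo evens_approx ^~ x : n m / (n <= m)%N >-> n <= m}.
Proof.
apply/nondecreasing_seqP => n; elim: n x => [|n IH] x.
  exact: evens_approx_ge0.
by have := IH (shift2 (shift2 x)); rewrite /= /half_add => ?; lra.
Qed.

Lemma evens_approx_cvg x : cvgn (evens_approx ^~ x).
Proof.
apply: nondecreasing_is_cvgn; first exact: evens_approx_nd.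
by exists 1 => _ [n _ <-]; exact: evens_approx_le1.
Qed.

(* The numbers whose binary digits are the digits of even, respectively odd,
   index of [x]. *)
Definition evens (x : R) : R := limn (evens_approx ^~ x).
Definition odds (x : R) : R := evens (shift2 x).

(** The recursion of [evens_approx] in the limit. Writing the tail as [odds (shift2 x)] shows that
    removing one digit exchanges [evens] and [odds]. *)
Lemma evensE x : evens x = half_add (digit x)%:R (odds (shift2 x)).
Proof.
apply/cvg_lim => //; rewrite -cvg_shiftS /half_add.
apply: cvgM; last exact: cvg_cst.
by apply: cvgD; [exact: cvg_cst|exact: evens_approx_cvg].
Qed.

Lemma evens_ge0 x : 0 <= evens x.
Proof.
apply: limr_ge; first exact: evens_approx_cvg.
by apply: nearW => n; exact: evens_approx_ge0.
Qed.

Lemma evens_le1 x : evens x <= 1.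
Proof.
apply: limr_le; first exact: evens_approx_cvg.
by apply: nearW => n; exact: evens_approx_le1.
Qed.

Lemma measurable_evens : measurable_fun (setT : set RR) (evens : RR -> RR).
Proof.
apply: (measurable_fun_cvg (h := evens_approx)) => [n|x _]; last first.
  exact: evens_approx_cvg.
elim: n => [|n IH] /=; first exact: measurable_cst.
apply: measurable_funM => //; apply: measurable_funD.
  rewrite (_ : (fun x => _) = fun x : RR => if digit x then 1 else 0 : R).
    by apply: measurable_fun_ifT => //; exact: measurable_digit.
  by apply/funext => x; case: (digit x).
apply: (measurableT_comp IH); apply: measurableT_comp measurable_shift2.
exact: measurable_shift2.
Qed.

Lemma measurable_odds : measurable_fun (setT : set RR) (odds : RR -> RR).
Proof. exact: measurableT_comp measurable_evens measurable_shift2. Qed.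

(** The supremum of [|f|], finite by the first hypothesis, is at most half of itself. *)
Lemma contraction_eq0 T (f : T -> R) : (forall x, `|f x| <= 1) ->
  (forall x, exists y, `|f x| <= 2^-1 * `|f y|) -> forall x, f x = 0.
Proof.
move=> f1 fh x; pose A := range (fun x => `|f x|).
have hA : has_sup A.
  by split; [exists `|f x|, x|exists 1 => _ [y _ <-]].
have leA y : `|f y| <= sup A by apply: sup_ubound; [exact: hA.2|exists y].
have : sup A <= 2^-1 * sup A.
  apply: ge_sup; first exact: hA.1.
  move=> _ [y _ <-]; have [z /le_trans] := fh y; apply.
  by have := leA z; lra.
have := leA x; have := normr_ge0 (f x) => ? ? ?.
by apply/eqP; rewrite -normr_eq0; apply/eqP; lra.
Qed.

Let dist (E : set RR) : R := fine (U E).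

Lemma dist_bound (E : set RR) : measurable E -> 0 <= dist E <= 1.
Proof.
move=> mE; rewrite /dist fine_ge0//= -lee_fin fineK ?fin_num_measure//.
exact: probability_le1.
Qed.

Lemma clamp_bound (x : R) : 0 <= clamp x <= 1.
Proof.
by rewrite clampE; case: (leP x 0) => ?; case: (leP x 1) => ?; lra.
Qed.

Lemma dist_digit (G : bool -> set RR) : (forall i, measurable (G i)) ->
  dist [set x | G (digit x) (shift2 x)] =
  2^-1 * dist (G false) + 2^-1 * dist (G true).
Proof.
move=> mG; rewrite /dist unif_digit// fineD ?fineM//.
- by rewrite fin_num_measure.
- by rewrite fin_num_measure.
- by rewrite fin_numM// fin_num_measure.
- by rewrite fin_numM// fin_num_measure.
Qed.

Let below (f : R -> R) (s : R) : set RR := [set x | f x <= s].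

Lemma measurable_below f s : measurable_fun (setT : set RR) (f : RR -> RR) ->
  measurable (below f s).
Proof.
move=> mf; have := mf measurableT `]-oo, s]%classic (measurable_itv _).
by rewrite setTI; congr measurable; apply/seteqP; split=> x/=; rewrite in_itv.
Qed.

Let marg s := dist (below evens s) - clamp s.

Lemma marg_step s : marg s = 2^-1 * marg (2 * s) + 2^-1 * marg (2 * s - 1).
Proof.
(* For a constant family the digit formula says that [shift2] preserves the uniform law. *)
have odds_evens r : dist (below odds r) = dist (below evens r).
  rewrite [LHS](dist_digit (G := fun=> below evens r)); first by lra.
  by move=> _; apply: measurable_below measurable_evens.
rewrite /marg clamp_split.
have -> : below evens s =
    [set x | (fun i : bool => below odds (2 * s - i%:R)) (digit x) (shift2 x)].
  by apply/seteqP; split => x; rewrite /below/= evensE /half_add => ?; lra.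
rewrite (dist_digit (G := fun i : bool => below odds (2 * s - i%:R))) /=.
  by rewrite !odds_evens subr0; lra.
by move=> i; apply: measurable_below measurable_odds.
Qed.

Lemma clamp_le0 (x : R) : x <= 0 -> clamp x = 0.
Proof. by rewrite clampE => ->. Qed.

Lemma clamp_ge1 (x : R) : 1 <= x -> clamp x = 1.
Proof.
by move=> ?; rewrite clampE; case: (leP x 0) => ?; case: (leP x 1) => ?; lra.
Qed.

Lemma marg_lt0 s : s < 0 -> marg s = 0.
Proof.
move=> s0; rewrite /marg clamp_le0 ?(ltW s0)// subr0 /dist.
rewrite (_ : below evens s = set0) ?measure0//.
by rewrite -subset0 => x; rewrite /below/=; have := evens_ge0 x; lra.
Qed.

Lemma marg_ge1 s : 1 <= s -> marg s = 0.
Proof.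
move=> s1; rewrite /marg clamp_ge1// /dist.
rewrite (_ : below evens s = setT) ?probability_setT ?subrr//.
by rewrite -subTset => x _; rewrite /below/=; have := evens_le1 x; lra.
Qed.

Lemma marg_eq0 s : marg s = 0.
Proof.
apply: contraction_eq0 => {s} s.
  have /andP[? ?] := clamp_bound s.
  have /andP[? ?] := dist_bound (measurable_below s measurable_evens).
  by rewrite /marg ler_norml; lra.
(* Either [2 * s >= 1], and the first term vanishes, or [2 * s - 1 < 0], and the second does. The
   single remaining term carries the factor 1/2 that [contraction_eq0] asks for. *)
rewrite (marg_step s); have [s1|s1] := leP 1 (2 * s).
  exists (2 * s - 1); rewrite (marg_ge1 s1) mulr0 add0r normrM.
  by rewrite (@ger0_norm _ 2^-1)// invr_ge0.
exists (2 * s); rewrite (@marg_lt0 (2 * s - 1)) ?subr_lt0//.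
by rewrite mulr0 addr0 normrM (@ger0_norm _ 2^-1)// invr_ge0.
Qed.

Let gap (st : R * R) :=
  dist (below evens st.1 `&` below odds st.2) - clamp st.1 * clamp st.2.

Let mbelow2 s t : measurable (below evens s `&` below odds t).
Proof.
by apply: measurableI; apply: measurable_below;
  [exact: measurable_evens|exact: measurable_odds].
Qed.

(* Reading off the first digit exchanges the roles of [evens] and [odds]. *)
Lemma gap_step s t :
  gap (s, t) = 2^-1 * gap (t, 2 * s) + 2^-1 * gap (t, 2 * s - 1).
Proof.
rewrite /gap/= (clamp_split s).
have -> : below evens s `&` below odds t =
    [set x | (fun i : bool => below evens t `&` below odds (2 * s - i%:R))
               (digit x) (shift2 x)].
  apply/seteqP; split => x; rewrite /below/= [in evens x]evensE /half_add.
    by move=> [? ?]; split => //; lra.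
  by move=> [? ?]; split => //; lra.
rewrite (dist_digit (G := fun i : bool =>
  below evens t `&` below odds (2 * s - i%:R))) //= subr0; lra.
Qed.

Lemma gap_lt0 s t : t < 0 -> gap (s, t) = 0.
Proof.
move=> t0; rewrite /gap/= (clamp_le0 (ltW t0)) mulr0 subr0 /dist.
rewrite (_ : _ `&` _ = set0) ?measure0//.
by rewrite -subset0 => x [_]; rewrite /below/= /odds; have := evens_ge0 (shift2 x); lra.
Qed.

(** As [odds] never exceeds 1, the second constraint is void and the gap is the error of the
    marginal law of [evens], which is why that law is settled first. *)
Lemma gap_ge1 s t : 1 <= t -> gap (s, t) = 0.
Proof.
move=> t1; rewrite -(marg_eq0 s) /gap /marg/= (clamp_ge1 t1) mulr1.
rewrite setIidl// => x _.
by rewrite /below/= /odds; have := evens_le1 (shift2 x); lra.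
Qed.

Lemma gap_eq0 st : gap st = 0.
Proof.
apply: contraction_eq0 => {st} -[s t].
  have /andP[? ?] := clamp_bound s; have /andP[? ?] := clamp_bound t.
  have /andP[? ?] := dist_bound (mbelow2 s t).
  have /andP[? ?] : 0 <= clamp s * clamp t <= 1.
    by rewrite mulr_ge0//= mulr_ile1.
  by rewrite /gap/= ler_norml; lra.
(* The same dichotomy now acts on the second coordinate, where [gap_step] has put [s]. *)
rewrite gap_step; have [s1|s1] := leP 1 (2 * s).
  exists (t, 2 * s - 1); rewrite (gap_ge1 _ s1) mulr0 add0r normrM.
  by rewrite (@ger0_norm _ 2^-1)// invr_ge0.
exists (t, 2 * s); rewrite (@gap_lt0 t (2 * s - 1)) ?subr_lt0//.
by rewrite mulr0 addr0 normrM (@ger0_norm _ 2^-1)// invr_ge0.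
Qed.

Lemma evens_odds_cdf s t :
  U (evens @^-1` `]-oo, s] `&` odds @^-1` `]-oo, t]) =
  (U `]-oo, s]%classic * U `]-oo, t]%classic)%E.
Proof.
have mA : measurable (evens @^-1` `]-oo, s] `&` odds @^-1` `]-oo, t] : set RR).
  apply: measurableI; rewrite -[X in measurable X]setTI.
    exact: measurable_evens.
  exact: measurable_odds.
rewrite !unif_cdf -EFinM -[LHS]fineK ?fin_num_measure//.
have /= /eqP := gap_eq0 (s, t); rewrite subr_eq0 => /eqP <-.
by rewrite /dist; congr (fine (U _))%:E; apply/seteqP; split=> x/=; rewrite !in_itv.
Qed.

(** [evens_odds_cdf] covers products of half-lines. One coordinate at a time is enlarged to Borel
    sets by [eq_law_halfline], first [odds] and then [evens], and measurable rectangles determine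
    the product measure. *)
Lemma evens_odds_law (C : set (RR * RR)) : measurable C ->
  U [set x | C (evens x, odds x)] = (U \x U)%E C.
Proof.
move=> mC; have mf : measurable_fun setT (fun x : RR => (evens x, odds x) : RR * RR).
  by apply: measurable_fun_pair; [exact: measurable_evens|exact: measurable_odds].
apply/esym; apply: (product_measure_unique (m' := law U mf)) => // A B mA mB.
have me s : measurable ((evens : RR -> RR) @^-1` `]-oo, s]).
  by rewrite -[X in measurable X]setTI; exact: measurable_evens.
have mo : measurable ((odds : RR -> RR) @^-1` B).
  by rewrite -[X in measurable X]setTI; exact: measurable_odds.
have AB s (B' : set RR) : measurable B' ->
    U (evens @^-1` `]-oo, s] `&` odds @^-1` B') =
    ((clamp s)%:E * U B')%E.
  apply: eq_law_halfline => //; first exact: measurable_odds.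
    by have /andP[] := clamp_bound s.
  by move=> t; rewrite evens_odds_cdf [X in (X * _)%E]unif_cdf.
transitivity (U (odds @^-1` B `&` evens @^-1` A)).
  by rewrite -[LHS]/(U _); congr (U _); apply/seteqP; split=> x [].
rewrite [RHS](_ : _ = ((fine (U B))%:E * U A)%E); last first.
  by rewrite fineK ?fin_num_measure// muleC.
apply: eq_law_halfline => //; first exact: measurable_evens.
  exact: fine_ge0.
move=> s; rewrite setIC AB// fineK ?fin_num_measure//.
by rewrite [X in _ = (_ * X)%E]unif_cdf muleC.
Qed.
End digits.

(** * Sampling from an arbitrary law on the line by its quantile function *)

Section quantile.
Context {R : realType}.
Notation RR := (measurableTypeR R).
Variable Q : probability RR R.

Let idTR : RR -> R := idfun.

#[local] HB.instance Definition _ :=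
  @isMeasurableFun.Build _ _ _ _ idTR (@measurable_id _ _ setT).

Let F (x : R) : R := fine (cdf (idTR : {RV Q >-> R}) x).

Let cdfE x : Q `]-oo, x]%classic = (F x)%:E.
Proof. by rewrite /F fineK ?fin_num_measure. Qed.

Let F_bound x : 0 <= F x <= 1.
Proof.
by rewrite /F -!lee_fin fineK ?fin_num_measure// cdf_ge0 cdf_le1.
Qed.

Let F_nd x y : x <= y -> F x <= F y.
Proof. by move=> ?; rewrite fine_le ?fin_num_measure// cdf_nondecreasing. Qed.

Let F_small (u : R) : 0 < u -> exists x, F x < u.
Proof.
move=> u0; have F0 : F x @[x --> -oo] --> (0 : R) by exact/fine_cvg/cvg_cdfNy0.
have [M [_ HM]] := cvgr_lt _ F0 _ u0.
by exists (M - 1); apply: HM; lra.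
Qed.

Let F_large (u : R) : u < 1 -> exists x, u <= F x.
Proof.
move=> u1; have F1 : F x @[x --> +oo] --> (1 : R) by exact/fine_cvg/cvg_cdfy1.
have [M [_ HM]] := cvgr_gt _ F1 _ u1.
by exists (M + 1); apply/ltW/HM; lra.
Qed.

Let F_rc x : F y @[y --> x^'+] --> F x.
Proof. by apply: fine_cvg; rewrite -cdfE; exact: cdf_right_continuous. Qed.

(** Generalized inverse of [F]. Outside ]0, 1[, a set of uniform measure 0, the default 0 replaces
    an infimum over a set that may be empty or unbounded below. *)
Definition quantile (u : R) : R :=
  if 0 < u < 1 then inf [set x | u <= F x] else 0.

(** If [quantile u <= x], every [y > x] satisfies [u <= F y], and right continuity gives [u <= F x].
    This Galois connection makes [F] the distribution function of [quantile] under [unif]. *)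
Lemma quantile_le (u x : R) : 0 < u < 1 -> (quantile u <= x) = (u <= F x).
Proof.
move=> /[dup] u01 /andP[u0 u1]; rewrite /quantile u01.
have lbS : has_inf [set x | u <= F x].
  split; first exact: F_large.
  have [y Fy] := F_small u0; exists y => z /= uz; rewrite leNgt.
  by apply/negP => /ltW /F_nd; lra.
apply/idP/idP => [qx|ux]; last exact: (ge_inf lbS.2).
apply: (cvgr_to_ge (@F_rc x)).
near=> y; have xy : x < y by near: y; exact: nbhs_right_gt.
have [z /= uz zy] : exists2 z, [set x | u <= F x] z & z < y.
    by apply: inf_lt; [exact: lbS.1|exact: le_lt_trans qx xy].
by apply: le_trans uz (F_nd (ltW zy)).
Unshelve. all: by end_near. Qed.

Lemma measurable_quantile : measurable_fun (setT : set RR) (quantile : RR -> RR).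
Proof.
apply: (measurability _ halfline_generates) => _ [_ [x ->] <-]; rewrite setTI.
(* The default value 0 contributes the complement of ]0, 1[ wholly or not at all, according to the
   sign of [x]. *)
rewrite (_ : _ @^-1` _ = (`]0, 1[ `&` `]-oo, F x]) `|`
    (~` `]0, 1[ `&` (if 0 <= x then setT else set0))).
  apply: measurableU; apply: measurableI => //; first exact: measurableC.
  by case: ifP.
apply/seteqP; split=> u /=; rewrite !in_itv/=.
  have [u01|u01] := boolP (0 < u < 1).
    by rewrite quantile_le//; left.
  by rewrite /quantile (negbTE u01) => ->; right.
move=> [[u01 uF]|[/negP u01]]; first by rewrite quantile_le.
by rewrite /quantile (negbTE u01); case: ifP.
Qed.

Lemma unif_quantile (B : set RR) : measurable B -> unif (quantile @^-1` B) = Q B.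
Proof.
move=> mB; rewrite -[RHS]mul1e -(setTI (_ @^-1` _)).
apply: eq_law_halfline => //; first exact: measurable_quantile.
move=> s; rewrite setTI mul1e cdfE.
have mq : measurable (quantile @^-1` `]-oo, s] : set RR).
  by rewrite -[X in measurable X]setTI; exact: measurable_quantile.
rewrite (@unif_ext _ _ `]-oo, F s]%classic)//; last first.
  by move=> u u01; rewrite /= !in_itv/= quantile_le.
rewrite unif_cdf clampE; congr _%:E; have /andP[F0 F1] := F_bound s.
by move: F0 F1; case: (leP (F s) 0) => ?; case: (leP (F s) 1) => ?; lra.
Qed.

End quantile.

(** * Simulation of a stationary policy *)

Section history.
Context {dX : measure_display} {X : measurableType dX}.

Let step_tuple t (h : t.-tuple X) (y : X) : t.+1.-tuple X := [tuple of rcons h y].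

Lemma tnth_rcons_lt t (h : t.-tuple X) (y : X) (i : 'I_t.+1) (it : (i < t)%N) :
  tnth (step_tuple h y) i = tnth h (Ordinal it).
Proof. by rewrite !(tnth_nth y)/= nth_rcons size_tuple it. Qed.

Lemma tnth_rcons_ge t (h : t.-tuple X) (y : X) (i : 'I_t.+1) : ~~ (i < t)%N ->
  tnth (step_tuple h y) i = y.
Proof.
move=> it; rewrite (tnth_nth y)/= nth_rcons size_tuple (negbTE it).
by case: ifP => //; have := ltn_ord i; lia.
Qed.

Lemma measurable_rcons d (T : measurableType d) t (h : T -> t.-tuple X)
    (y : T -> X) : measurable_fun setT h -> measurable_fun setT y ->
  measurable_fun setT (fun w => [tuple of rcons (h w) (y w)] : t.+1.-tuple X).
Proof.
move=> mh my; apply/measurable_fun_tnthP => i.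
have [it|it] := boolP (i < t)%N.
  rewrite (_ : _ \o _ = fun w => tnth (h w) (Ordinal it)).
    exact: (measurableT_comp (measurable_tnth _)).
  by apply/funext => w /=; rewrite tnth_rcons_lt.
rewrite (_ : _ \o _ = y)//.
by apply/funext => w /=; rewrite tnth_rcons_ge.
Qed.

End history.

Lemma pastS d (X : measurableType d) d' (T : measurableType d')
    (S : nat -> T -> X) (U : nat -> T -> bool) t w :
  past S U t.+1 w = [tuple of rcons (past S U t w) (S t w, U t w)].
Proof.
apply: eq_from_tnth => i; rewrite tnth_mktuple.
have [it|it] := boolP (i < t)%N.
  by rewrite tnth_rcons_lt tnth_mktuple.
rewrite tnth_rcons_ge// (_ : val i = t)//=.
by have := ltn_ord i; lia.
Qed.

(** * A process driven by the digits of one uniform number *)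

Section simulation.
Context {R : realType} {dX : measure_display} {X : measurableType dX}.
Notation RR := (measurableTypeR R).
Notation U := (@unif R).
Variables (F : X -> bool -> RR -> X) (act : X -> bool) (x0 : X).
Hypothesis mF : measurable_fun setT (fun p : (X * bool) * RR => F p.1.1 p.1.2 p.2).
Hypothesis mact : measurable_fun setT act.

(* Current state together with the number whose digits are still unused. *)
Fixpoint sim (t : nat) (w : RR) : X * RR :=
  if t is t'.+1 then
    let: (s, r) := sim t' w in (F s (act s) (evens r), odds r)
  else (x0, w).

Definition sim_state t w := (sim t w).1.
Definition sim_action t w := act (sim_state t w).
Definition sim_rest t w := (sim t w).2.
Definition sim_hist t w : (t.-tuple (X * bool) * X)%type :=
  (past sim_state sim_action t w, sim_state t w).

Lemma sim_stateS t w :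
  sim_state t.+1 w = F (sim_state t w) (act (sim_state t w)) (evens (sim_rest t w)).
Proof. by rewrite /sim_state /sim_rest/=; case: (sim t w). Qed.

Lemma sim_restS t w : sim_rest t.+1 w = odds (sim_rest t w).
Proof. by rewrite /sim_rest/=; case: (sim t w). Qed.

Let step (s : X) (r : RR) : X := F s (act s) r.

Let measurable_step d (T : measurableType d) (f : T -> X) (g : T -> RR) :
  measurable_fun setT f -> measurable_fun setT g ->
  measurable_fun setT (fun w => step (f w) (g w)).
Proof.
move=> mf mg; apply: (measurableT_comp mF (g := fun w => ((f w, act (f w)), g w))).
apply: measurable_fun_pair => //; apply: measurable_fun_pair => //.
exact: measurableT_comp mact mf.
Qed.

Lemma measurable_sim_rest t : measurable_fun setT (sim_rest t).
Proof.
elim: t => [|t IH]; first exact: measurable_id.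
rewrite (_ : sim_rest _ = odds \o sim_rest t); last first.
  by apply/funext => w /=; rewrite sim_restS.
exact: measurableT_comp measurable_odds IH.
Qed.

Lemma measurable_sim_state t : measurable_fun setT (sim_state t).
Proof.
elim: t => [|t IH]; first exact: measurable_cst.
rewrite (_ : sim_state _ = fun w => step (sim_state t w) (evens (sim_rest t w))).
  apply: measurable_step => //.
  by apply: measurableT_comp measurable_evens _; exact: measurable_sim_rest.
by apply/funext => w /=; rewrite sim_stateS.
Qed.

Lemma measurable_sim_hist t : measurable_fun setT (sim_hist t).
Proof.
apply: measurable_fun_pair; last exact: measurable_sim_state.
apply/measurable_fun_tnthP => i.
rewrite (_ : _ \o _ = fun w => (sim_state i w, sim_action i w)); last first.
  by apply/funext => w /=; rewrite tnth_mktuple.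
apply: measurable_fun_pair; first exact: measurable_sim_state.
by apply: measurableT_comp mact _; exact: measurable_sim_state.
Qed.

Let next_hist t (p : (t.-tuple (X * bool) * X) * RR) :
    (t.+1.-tuple (X * bool) * X)%type :=
  ([tuple of rcons p.1.1 (p.1.2, act p.1.2)], step p.1.2 p.2).

Let measurable_next_hist t : measurable_fun setT (@next_hist t).
Proof.
have m12 : measurable_fun setT
    (fun p : (t.-tuple (X * bool) * X) * RR => p.1.2).
  exact: measurableT_comp measurable_snd measurable_fst.
apply: measurable_fun_pair; last exact: measurable_step.
apply: measurable_rcons.
  exact: measurableT_comp measurable_fst measurable_fst.
by apply: measurable_fun_pair => //; exact: measurableT_comp mact m12.
Qed.

Lemma sim_histS t w :
  sim_hist t.+1 w = next_hist (sim_hist t w, evens (sim_rest t w)).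
Proof. by rewrite /sim_hist pastS sim_stateS. Qed.

Let mpair t : measurable_fun setT (fun w => (sim_hist t w, sim_rest t w)).
Proof.
apply: measurable_fun_pair; first exact: measurable_sim_hist.
exact: measurable_sim_rest.
Qed.

(** The next history uses only the even digits of the rest, and the next rest consists of the odd
    ones. [evens_odds_law] makes these independent and uniform, so the independence of history and
    rest propagates. *)
Lemma sim_indep t (C : set ((t.-tuple (X * bool) * X) * RR)) : measurable C ->
  U [set w | C (sim_hist t w, sim_rest t w)] =
  (law U (@measurable_sim_hist t) \x U)%E C.
Proof.
elim: t C => [|t IH] C mC; apply/esym.
  apply: (product_measure_unique (m' := law U (@mpair 0))) => // A B mA mB.
  transitivity (U (sim_hist 0 @^-1` A `&` B)); first by [].
  (* At time 0 the history is constant, so each event on it is everything or empty. *)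
  have hE w : sim_hist 0 w = sim_hist 0 0.
    by congr pair; apply: eq_from_tnth; case.
  transitivity (U (sim_hist 0 @^-1` A) * U B)%E; last by [].
  have [A0|A0] := pselect (A (sim_hist 0 0)).
    have -> : sim_hist 0 @^-1` A = setT.
      by rewrite -subTset => w _ /=; rewrite hE.
    by rewrite setTI probability_setT mul1e.
  have -> : sim_hist 0 @^-1` A = set0.
    by rewrite -subset0 => w /=; rewrite hE.
  by rewrite set0I measure0 mul0e.
apply: (product_measure_unique (m' := law U (@mpair t.+1))) => // A B mA mB.
have mnA : measurable (@next_hist t @^-1` A).
  by rewrite -[X in measurable X]setTI; exact: measurable_next_hist.
(* The first factor does not depend on [B'], so the case [B' = setT] below identifies it as the
   probability of the event on the history. *)
have key B' : measurable B' ->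
    U [set w | A (sim_hist t.+1 w) /\ B' (sim_rest t.+1 w)] =
    ((\int[law U (@measurable_sim_hist t)]_h
       U (xsection (@next_hist t @^-1` A) h)) * U B')%E.
  move=> mB'.
  pose E := [set p : (t.-tuple (X * bool) * X) * RR |
               A (next_hist (p.1, evens p.2)) /\ B' (odds p.2)].
  have mE : measurable E.
    apply: measurableI.
      rewrite -[X in measurable X]setTI.
      apply: (measurableT_comp (@measurable_next_hist t)
               (g := fun p => (p.1, evens p.2))) => //.
      apply: measurable_fun_pair => //.
      exact: measurableT_comp measurable_evens measurable_snd.
    rewrite -[X in measurable X]setTI.
    by apply: (measurableT_comp measurable_odds measurable_snd).
  rewrite (_ : [set w | _] = [set w | E (sim_hist t w, sim_rest t w)]); last first.
    by apply/seteqP; split=> w /=; rewrite /E/= sim_histS sim_restS.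
  rewrite IH// /product_measure1 -ge0_integralZr//; last first.
    exact: measurable_fun_xsection.
  apply: eq_integral => h _ /=.
  have mx : measurable (xsection (@next_hist t @^-1` A) h).
    exact: measurable_xsection.
  transitivity ((U \x U)%E (xsection (@next_hist t @^-1` A) h `*` B')).
    rewrite -evens_odds_law; last exact: measurableX.
    congr (U _); apply/seteqP; split=> r /=.
      by rewrite /xsection/= !inE.
    by rewrite /xsection/= !inE.
  exact: product_measure1E.
transitivity (U [set w | A (sim_hist t.+1 w) /\ B (sim_rest t.+1 w)]); first by [].
rewrite key//; congr (_ * _)%E.
transitivity (U [set w | A (sim_hist t.+1 w) /\ setT (sim_rest t.+1 w)]).
  by rewrite key// probability_setT mule1.
rewrite -[RHS]/(U (sim_hist t.+1 @^-1` A)).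
by congr (U _); apply/seteqP; split=> w //= [].
Qed.

Lemma measurable_stationary_policy :
  measurable_policy (fun t (_ : t.-tuple (X * bool)) s => act s).
Proof. by move=> t; exact: measurableT_comp mact measurable_snd. Qed.

(** The process starts in [D] and never leaves it, so along every path the kernel [trans] is the law
    of [F] applied to a uniform number. *)
Lemma sim_controlled (trans : X -> bool -> set X -> \bar R) (D : set X) :
  D x0 -> (forall s u r, D s -> D (F s u r)) ->
  (forall s u B, D s -> measurable B -> trans s u B = U [set r | B (F s u r)]) ->
  controlled_process trans U sim_state sim_action
    (fun t (_ : t.-tuple (X * bool)) s => act s) x0.
Proof.
move=> Dx0 DF transE; split => //; first exact: measurable_sim_state.
move=> t A B mA mB.
have Dsim w : D (sim_state t w).
  by elim: t {A mA} => // t IH; rewrite sim_stateS; exact: DF.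
have mE : measurable [set p : (t.-tuple (X * bool) * X) * RR |
    A p.1 /\ B (step p.1.2 (evens p.2))].
  apply: measurableI; rewrite -[X in measurable X]setTI.
    exact: (measurable_fst measurableT _ mA).
  have mg : measurable_fun setT (fun p : (t.-tuple (X * bool) * X) * RR =>
      step p.1.2 (evens p.2)).
    apply: measurable_step; first exact: measurableT_comp measurable_snd measurable_fst.
    exact: measurableT_comp measurable_evens measurable_snd.
  exact: mg.
have mS : measurable [set p : (t.-tuple (X * bool) * X) * RR | B (step p.1.2 p.2)].
  rewrite -[X in measurable X]setTI.
  have mg : measurable_fun setT (fun p : (t.-tuple (X * bool) * X) * RR =>
      step p.1.2 p.2).
    apply: measurable_step => //.
    exact: measurableT_comp measurable_snd measurable_fst.
  exact: mg.
transitivity (U [set w | [set p : (t.-tuple (X * bool) * X) * RR |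
    A p.1 /\ B (step p.1.2 (evens p.2))] (sim_hist t w, sim_rest t w)]).
  by congr (U _); apply/seteqP; split=> w /=; rewrite sim_stateS.
rewrite sim_indep// /product_measure1.
pose g h := U (xsection [set p : (t.-tuple (X * bool) * X) * RR |
  B (step p.1.2 p.2)] h).
transitivity (\int[law U (@measurable_sim_hist t)]_(h in A) g h)%E.
  rewrite [RHS]integral_mkcond; apply: eq_integral => h _ /=; rewrite /patch.
  case: ifPn => [/set_mem Ah|hA]; last first.
    rewrite (_ : xsection _ _ = set0) ?measure0//.
    rewrite -subset0 => r; rewrite /xsection/= inE/= => -[].
    by move: hA; rewrite notin_setE.
  rewrite /g; set G := xsection _ h; set G' := xsection _ h.
  have mG' : measurable G' by exact: measurable_xsection.
  (* Only the even digits of the rest enter, so the event is a cylinder in the pair of [evens] and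
     [odds]. *)
  transitivity (U [set r | (G' `*` setT) (evens r, odds r)]).
    congr (U _); apply/seteqP; split=> r /=; rewrite /G /G' /xsection/= !inE/=.
      by move=> -[].
    by move=> -[].
  rewrite evens_odds_law; last exact: measurableX.
  by rewrite product_measure1E// [X in (_ * X)%E](probability_setT U) mule1.
have mg : measurable_fun setT g by exact: measurable_fun_xsection.
rewrite (ge0_integral_pushforward (@measurable_sim_hist t) U)//; last first.
  exact: measurable_funS mg.
apply: eq_integral => w _ /=; rewrite /g transE//.
by congr (U _); apply/seteqP; split=> r /=; rewrite /xsection/= inE.
Qed.

End simulation.

(** * Value iteration *)

Lemma mine_mono (R : realType) (a b c d : \bar R) :
  (a <= c -> b <= d -> mine a b <= mine c d)%E.
Proof. by move=> ac bd; rewrite le_min !ge_min ac bd orbT. Qed.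

Section value_iteration.
Context {R : realType} {dX : measure_display} {X : measurableType dX}.
Notation RR := (measurableTypeR R).
Notation U := (@unif R).
Variables (F : X -> bool -> RR -> X) (cost : X -> bool -> R) (beta : R).
Hypothesis mF : measurable_fun setT (fun p : (X * bool) * RR => F p.1.1 p.1.2 p.2).
Hypothesis mcost : measurable_fun setT (fun p : X * bool => cost p.1 p.2).
Hypothesis cost_ge0 : forall x u, 0 <= cost x u.
Hypothesis beta_ge0 : 0 <= beta.

Local Open Scope ereal_scope.

Definition expect_next (f : X -> \bar R) (x : X) (u : bool) : \bar R :=
  \int[U]_r f (F x u r).

Definition action_value (f : X -> \bar R) (x : X) (u : bool) : \bar R :=
  (cost x u)%:E + beta%:E * expect_next f x u.

Definition bellman (f : X -> \bar R) (x : X) : \bar R :=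
  mine (action_value f x false) (action_value f x true).

Fixpoint value_iter (n : nat) : X -> \bar R :=
  if n is m.+1 then bellman (value_iter m) else cst 0.

Definition value (x : X) : \bar R := limn (value_iter ^~ x).

Lemma measurable_Fxu x u : measurable_fun setT (F x u).
Proof.
by apply: (measurableT_comp mF (g := fun r => ((x, u), r))); exact: pair1_measurable.
Qed.

Lemma expect_next_ge0 f x u : (forall y, 0 <= f y) -> 0 <= expect_next f x u.
Proof. by move=> f0; exact: integral_ge0. Qed.

Lemma action_value_ge0 f x u : (forall y, 0 <= f y) -> 0 <= action_value f x u.
Proof.
by move=> f0; rewrite adde_ge0 ?lee_fin// mule_ge0 ?lee_fin ?expect_next_ge0.
Qed.

Lemma measurable_expect_next f : measurable_fun setT f -> (forall y, 0 <= f y) ->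
  measurable_fun setT (fun p : X * bool => expect_next f p.1 p.2).
Proof.
move=> mf f0.
apply: (@measurable_fun_fubini_tonelli_F _ _ _ _ _ U
  (fun p : (X * bool) * RR => f (F p.1.1 p.1.2 p.2))) => //.
exact: measurableT_comp mf mF.
Qed.

Lemma measurable_action_value f : measurable_fun setT f -> (forall y, 0 <= f y) ->
  measurable_fun setT (fun p : X * bool => action_value f p.1 p.2).
Proof.
move=> mf f0; apply: emeasurable_funD; first exact/measurable_EFinP.
apply: emeasurable_funM; first exact: measurable_cst.
exact: measurable_expect_next.
Qed.

Lemma measurable_action_value1 f u : measurable_fun setT f ->
  (forall y, 0 <= f y) -> measurable_fun setT (fun x => action_value f x u).
Proof.
move=> mf f0.
by apply: (measurableT_comp (measurable_action_value mf f0) (g := pair^~ u)).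
Qed.

Lemma value_iter_ge0 n x : 0 <= value_iter n x.
Proof.
elim: n x => //= n IH x; rewrite /bellman le_min.
by rewrite !action_value_ge0.
Qed.

Lemma measurable_value_iter n : measurable_fun setT (value_iter n).
Proof.
elim: n => [|n IH]; first exact: measurable_cst.
by apply: measurable_mine; apply: measurable_action_value1 => //;
  exact: value_iter_ge0.
Qed.

Lemma le_action_value f g x u : measurable_fun setT f -> measurable_fun setT g ->
  (forall y, 0 <= f y) -> (forall y, f y <= g y) ->
  action_value f x u <= action_value g x u.
Proof.
move=> mf mg f0 fg; rewrite leeD2l// lee_wpmul2l ?lee_fin//.
by apply: ge0_le_integral => //; apply: measurableT_comp => //; exact: measurable_Fxu.
Qed.

Lemma value_iter_nd x : {homo value_iter ^~ x : n m / (n <= m)%N >-> n <= m}.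
Proof.
apply/nondecreasing_seqP => n; elim: n x => [|n IH] x.
  exact: value_iter_ge0.
have h u : action_value (value_iter n) x u <= action_value (value_iter n.+1) x u.
  apply: le_action_value => //; try exact: measurable_value_iter.
  exact: value_iter_ge0.
exact: mine_mono.
Qed.

Lemma value_iter_cvg x : value_iter n x @[n --> \oo] --> value x.
Proof.
by apply: ereal_nondecreasing_is_cvgn; exact: value_iter_nd.
Qed.

Lemma value_iter_le n x : value_iter n x <= value x.
Proof.
have h := ereal_nondecreasing_cvgn (@value_iter_nd x).
by rewrite /value (cvg_lim _ h)//; apply: ereal_sup_ubound; exists n.
Qed.

Lemma value_ge0 x : 0 <= value x.
Proof. exact: le_trans (value_iter_ge0 0 x) (value_iter_le 0 x). Qed.

Lemma measurable_value : measurable_fun setT value.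
Proof.
apply: (emeasurable_fun_cvg value_iter) => [n|x _]; last exact: value_iter_cvg.
exact: measurable_value_iter.
Qed.

Lemma action_value_cvg x u :
  action_value (value_iter n) x u @[n --> \oo] --> action_value value x u.
Proof.
apply: cvgeD => //; first exact: cvg_cst.
apply: cvgeZl => //.
apply: cvg_monotone_convergence => //.
- move=> n; apply: measurableT_comp; first exact: measurable_value_iter.
  exact: measurable_Fxu.
- by move=> n r _; exact: value_iter_ge0.
- by move=> r _; exact: value_iter_nd.
Qed.

(** The iterates increase, so monotone convergence passes the limit through the expectation, and the
    minimum of two action values is continuous. *)
Lemma value_bellman x : value x = bellman value x.
Proof.
have h : value_iter n.+1 x @[n --> \oo] --> value x.
  by rewrite (cvg_shiftS (value_iter ^~ x)); exact: value_iter_cvg.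
apply: (cvg_unique _ h) => //.
exact: (cvg_comp2 (@action_value_cvg x false) (@action_value_cvg x true)
  (@min_continuous _ (\bar R) (_, _))).
Qed.

End value_iteration.

(** * Costs of arbitrary processes against the limit of value iteration *)

Section cost_of_process.
Context {R : realType} {dX : measure_display} {X : measurableType dX}.
Notation RR := (measurableTypeR R).
Notation U := (@unif R).
Variables (F : X -> bool -> RR -> X) (cost : X -> bool -> R) (beta : R).
Hypothesis mF : measurable_fun setT (fun p : (X * bool) * RR => F p.1.1 p.1.2 p.2).
Hypothesis mcost : measurable_fun setT (fun p : X * bool => cost p.1 p.2).
Hypothesis cost_ge0 : forall x u, 0 <= cost x u.
Hypothesis beta_ge0 : 0 <= beta.
Variables (trans : X -> bool -> set X -> \bar R) (D : set X).
Hypothesis mD : measurable D.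
Hypothesis DF : forall s u r, D s -> D (F s u r).
Hypothesis transE : forall s u B, D s -> measurable B ->
  trans s u B = U [set r | B (F s u r)].

Section process.
Context {dO : measure_display} {Omega : measurableType dO}.
Variables (P : probability Omega R) (S : nat -> Omega -> X)
  (A : nat -> Omega -> bool) (phi : @policy dX X) (x : X).
Hypotheses (mphi : measurable_policy phi)
  (cp : controlled_process trans P S A phi x) (Dx : D x).

Local Open Scope ereal_scope.

Let mS t : measurable_fun setT (S t) := process_measurable cp t.

Lemma measurable_process_action t : measurable_fun setT (A t).
Proof.
(* Strong induction, since the action at time [t] depends on all earlier actions through [past]. *)
elim/ltn_ind: t => t IH.
rewrite (_ : A t = (fun h => phi h.1 h.2) \o (fun w => (past S A t w, S t w))).
  apply: measurableT_comp; first exact: mphi.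
  apply: measurable_fun_pair => //; apply/measurable_fun_tnthP => i.
  rewrite (_ : _ \o _ = fun w => (S i w, A i w)).
    by apply: measurable_fun_pair => //; exact: IH.
  by apply/funext => w /=; rewrite tnth_mktuple.
by apply/funext => w /=; rewrite (process_action cp).
Qed.

(** The next state as it would be produced by a fresh uniform number independent of the process. *)
Let G t (p : Omega * RR) : X := F (S t p.1) (A t p.1) p.2.

Let mG t : measurable_fun setT (@G t).
Proof.
apply: (measurableT_comp mF (g := fun p => ((S t p.1, A t p.1), p.2))).
apply: measurable_fun_pair => //; apply: measurable_fun_pair.
  exact: measurableT_comp (@mS t) measurable_fst.
exact: measurableT_comp (@measurable_process_action t) measurable_fst.
Qed.

Let mGB t B : measurable B -> measurable (@G t @^-1` B).
Proof. by move=> mB; rewrite -[X in measurable X]setTI; exact: mG. Qed.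

Let mSB t B : measurable B -> measurable (S t @^-1` B).
Proof. by move=> mB; rewrite -[X in measurable X]setTI; exact: mS. Qed.

(** [trans] is known to agree with [F] only on [D]. The history event passed to [process_next] is
    therefore that the current state lies in [D]; having full probability, it leaves both sides
    unchanged. *)
Lemma process_next_inD t B : P (S t @^-1` D) = 1 -> measurable B ->
  P (S t.+1 @^-1` B) = (P \x U) (@G t @^-1` B).
Proof.
move=> SD mB.
have mg : measurable_fun setT (fun w => U (xsection (@G t @^-1` B) w)).
  by apply: measurable_fun_xsection; exact: mGB.
rewrite -(measureI_full (@mSB t.+1 _ mB) (@mSB t _ mD) SD) setIC.
have mA' : measurable [set h : t.-tuple (X * bool) * X | D h.2].
  by rewrite -[X in measurable X]setTI; exact: (measurable_snd measurableT _ mD).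
rewrite (process_next cp mA' mB).
transitivity (\int[P]_(w in S t @^-1` D) U (xsection (@G t @^-1` B) w)).
  apply: eq_integral => w /[!inE] Dw; rewrite transE//; congr (U _).
  by apply/seteqP; split=> r; rewrite /xsection/= inE.
rewrite /product_measure1.
by rewrite integral_full//; exact: mSB.
Qed.

Lemma process_inD t : P (S t @^-1` D) = 1.
Proof.
elim: t => [|t IH].
  rewrite -[RHS](probability_setT P); congr (P _).
  by rewrite -subTset => w _ /=; rewrite (process_init cp).
rewrite process_next_inD// /product_measure1.
have mg : measurable_fun setT (fun w => U (xsection (@G t @^-1` D) w)).
  by apply: measurable_fun_xsection; exact: mGB.
rewrite -[LHS](integral_full (@mSB t _ mD) IH mg)//.
rewrite (eq_integral (cst 1)).
  by rewrite integral_cst ?mul1e//; exact: mSB.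
move=> w /[!inE] Dw; rewrite (_ : xsection _ _ = setT) ?probability_setT//.
by rewrite -subTset => r _; rewrite /xsection/= inE; exact: DF.
Qed.

(** The law of [S t.+1] is the image of [P \x U] under [G t]; Tonelli's theorem integrates the
    uniform number out first. *)
Lemma integral_process_next t (f : X -> \bar R) : measurable_fun setT f ->
  (forall y, 0 <= f y) ->
  \int[P]_w f (S t.+1 w) = \int[P]_w expect_next F f (S t w) (A t w).
Proof.
move=> mf f0; rewrite -(ge0_integral_law P (@mS t.+1) mf f0).
transitivity (\int[pushforward (P \x U) (@G t)]_y f y).
  apply: (eq_measure_integral
    (measure_function_pushforward__canonical__measure_function_Measure
       (P \x U) (@mG t))) => B mB _.
  exact: process_next_inD (process_inD t) mB.
rewrite (ge0_integral_pushforward (@mG t) (P \x U)%E)// preimage_setT.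
rewrite fubini_tonelli1//=; last exact: measurableT_comp mf (@mG t).
Qed.

Let stage t := \int[P]_w (cost (S t w) (A t w))%:E.

Let mSA t : measurable_fun setT (fun w => (S t w, A t w)).
Proof.
apply: measurable_fun_pair; first exact: mS.
exact: measurable_process_action.
Qed.

Lemma integral_action_value t (f : X -> \bar R) : measurable_fun setT f ->
  (forall y, 0 <= f y) ->
  \int[P]_w action_value F cost beta f (S t w) (A t w) =
  stage t + beta%:E * \int[P]_w f (S t.+1 w).
Proof.
move=> mf f0; rewrite integral_process_next//.
have mE : measurable_fun setT (fun w => expect_next F f (S t w) (A t w)).
  exact: (measurableT_comp (measurable_expect_next mF mf f0) (@mSA t)).
have E0 w : 0 <= expect_next F f (S t w) (A t w) by exact: expect_next_ge0.
rewrite -ge0_integralZl ?lee_fin// -ge0_integralD//.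
- by move=> w _; rewrite lee_fin.
- apply/measurable_EFinP; exact: (measurableT_comp mcost (@mSA t)).
- by move=> w _; rewrite mule_ge0 ?lee_fin.
- by apply: emeasurable_funM => //; exact: measurable_cst.
Qed.

Lemma stage_ge0 t : 0 <= stage t.
Proof. by apply: integral_ge0 => w _; rewrite lee_fin. Qed.

Lemma discounted_costE :
  discounted_cost cost P S A beta = \sum_(0 <= t <oo) (beta ^+ t)%:E * stage t.
Proof.
rewrite /discounted_cost integral_nneseries//; last 2 first.
- move=> t; apply/measurable_EFinP; apply: measurable_funM => //.
  exact: (measurableT_comp mcost (@mSA t)).
- by move=> t w _; rewrite lee_fin mulr_ge0// exprn_ge0.
apply: eq_eseriesr => t _; rewrite -ge0_integralZl//.
- by apply/measurable_EFinP; exact: (measurableT_comp mcost (@mSA t)).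
- by move=> w _; rewrite lee_fin.
- by rewrite lee_fin exprn_ge0.
Qed.

(** Cost of [n] stages from time [t] on, discounted back to [t]; the free starting time supports
    induction on [n]. *)
Let partial_cost n t := \sum_(i < n) (beta ^+ i)%:E * stage (t + i).

Let partial_costS n t :
  partial_cost n.+1 t = stage t + beta%:E * partial_cost n t.+1.
Proof.
rewrite /partial_cost big_ord_recl expr0 mul1e addn0; congr (_ + _).
rewrite ge0_sume_distrr; last first.
  by move=> i _; rewrite mule_ge0 ?stage_ge0// lee_fin exprn_ge0.
by apply: eq_bigr => i _; rewrite muleA -EFinM -exprS addSnnS.
Qed.

(** A Bellman step takes the smaller of the two action values, hence at most that of the action
    actually taken; each step splits off one stage cost. *)
Lemma value_iter_le_partial n t :
  \int[P]_w value_iter F cost beta n (S t w) <= partial_cost n t.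
Proof.
have mv m := measurable_value_iter mF mcost cost_ge0 beta_ge0 m.
have v0 m := value_iter_ge0 F cost_ge0 beta_ge0 m.
elim: n t => [|n IH] t; first by rewrite /= integral0 /partial_cost big_ord0.
rewrite partial_costS.
apply: (@le_trans _ _ (stage t +
    beta%:E * \int[P]_w value_iter F cost beta n (S t.+1 w))); last first.
  by rewrite leeD2l// lee_wpmul2l ?lee_fin.
rewrite -integral_action_value//.
apply: ge0_le_integral => //.
- exact: measurableT_comp (mv n.+1) (@mS t).
- exact: (measurableT_comp
    (measurable_action_value beta mF mcost (mv n) (v0 n)) (@mSA t)).
- by move=> w _; rewrite /= /bellman ge_min; case: (A t w); rewrite lexx ?orbT.
Qed.

Let integral_init (f : X -> \bar R) : \int[P]_w f (S 0%N w) = f x.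
Proof.
rewrite (eq_integral (cst (f x))); last first.
  by move=> w _; rewrite (process_init cp).
by rewrite integral_cst// [X in _ * X](probability_setT P) mule1.
Qed.

Let partial_costE n : partial_cost n 0 =
  \sum_(0 <= t < n) (beta ^+ t)%:E * stage t.
Proof. by rewrite big_mkord. Qed.

Let term_ge0 t : 0 <= (beta ^+ t)%:E * stage t.
Proof. by rewrite mule_ge0 ?stage_ge0// lee_fin exprn_ge0. Qed.

Lemma value_le_discounted_cost :
  value F cost beta x <= discounted_cost cost P S A beta.
Proof.
apply: lime_le.
  by apply: ereal_nondecreasing_is_cvgn; exact: value_iter_nd.
apply: nearW => n; rewrite -(integral_init (value_iter F cost beta n)).
apply: le_trans (value_iter_le_partial n 0) _.
rewrite discounted_costE partial_costE.
exact: nneseries_lim_ge.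
Qed.

(** Unrolling Bellman's equation along the greedy action leaves a finite-horizon cost plus a
    discounted expected value, which is nonnegative and dropped. Hence every partial sum of the cost
    is at most the value. *)
Lemma discounted_cost_le_value :
  (forall t w, value F cost beta (S t w) =
     action_value F cost beta (value F cost beta) (S t w) (A t w)) ->
  discounted_cost cost P S A beta <= value F cost beta x.
Proof.
move=> greedy; rewrite discounted_costE.
have mv := measurable_value mF mcost cost_ge0 beta_ge0.
have v0 := value_ge0 mF mcost cost_ge0 beta_ge0.
have key n t : partial_cost n t <= \int[P]_w value F cost beta (S t w).
  elim: n t => [|n IH] t.
    by rewrite /partial_cost big_ord0; exact: integral_ge0.
  rewrite (eq_integral (fun w => action_value F cost beta (value F cost beta)
    (S t w) (A t w))); last by move=> w _; exact: greedy.
  by rewrite integral_action_value// partial_costS leeD2l// lee_wpmul2l ?lee_fin.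
apply: lime_le; first exact: is_cvg_nneseries.
by apply: nearW => n; rewrite -partial_costE -(integral_init (value F cost beta)).
Qed.

End process.

Theorem optimal_value_eq x : D x ->
  optimal_value trans cost beta x = value F cost beta x.
Proof.
move=> Dx; apply/eqP; rewrite eq_le; apply/andP; split; last first.
  apply: le_ereal_inf_tmp => _ [phi [mphi [dO [Om [P [S [A [cp ->]]]]]]]].
  exact: (value_le_discounted_cost mphi cp Dx).
pose v := value F cost beta.
have mv : measurable_fun setT v := measurable_value mF mcost cost_ge0 beta_ge0.
have v0 := value_ge0 mF mcost cost_ge0 beta_ge0.
(* The greedy action for [v]; a tie is resolved by the action [false]. *)
pose act s := (action_value F cost beta v s true < action_value F cost beta v s false)%E.
have mact : measurable_fun setT act.
  by apply: measurable_fun_lte; apply: measurable_action_value1.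
have mp := measurable_stationary_policy mact.
have cp := sim_controlled mF mact Dx DF transE.
(* The infimum is bounded by the cost of the greedy policy run on the simulated process. *)
apply: ge_ereal_inf.
exists (discounted_cost cost U (sim_state F act x) (sim_action F act x) beta).
  exists (fun t _ s => act s); split => //.
  by exists _, _, U, (sim_state F act x), (sim_action F act x).
apply: (discounted_cost_le_value mp cp Dx) => // t w.
rewrite [LHS]value_bellman// /sim_action /bellman -/v /act.
by have [] := ltP (action_value F cost beta v (sim_state F act x t w) true)
                  (action_value F cost beta v (sim_state F act x t w) false).
Qed.

End cost_of_process.

(** * The two channel problems *)

Section gaussian.
Context {R : realType}.
Notation RR := (measurableTypeR R).
Notation mu := (@lebesgue_measure R).
Notation N01 := (normal_prob (0 : R) 1).

Lemma gaussE (x : R) : normal_pdf 0 1 x = gauss x.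
Proof.
rewrite normal_pdfE ?oner_eq0// /normal_peak /normal_fun /gauss mulrC subr0.
by rewrite expr1n mul1r -[pi *+ 2]mulr_natl.
Qed.

Lemma gauss_ge0 (x : R) : 0 <= gauss x.
Proof. by rewrite -gaussE normal_pdf_ge0. Qed.

Lemma measurable_gauss : measurable_fun setT (gauss : RR -> RR).
Proof.
rewrite (_ : gauss = normal_pdf 0 1); first exact: measurable_normal_pdf.
by apply/funext => x; rewrite gaussE.
Qed.

Lemma gaussN (x : R) : gauss (- x) = gauss x.
Proof. by rewrite /gauss sqrrN. Qed.

Local Open Scope ereal_scope.

(** The Radon-Nikodym derivative of the normal law agrees almost everywhere with [gauss], both
    having the same integral over every measurable set. *)
Lemma ge0_integral_normal (f : RR -> \bar R) : measurable_fun setT f ->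
  (forall x, 0 <= f x) ->
  \int[N01]_x f x = \int[mu]_x (f x * (gauss x)%:E).
Proof.
move=> mf f0; have dom := normal_prob_dominates (0 : R) 1.
rewrite -(Radon_Nikodym_SigmaFinite.change_of_variables dom f0 measurableT mf).
have mg : measurable_fun setT (fun x : RR => (gauss x)%:E).
  by apply/measurable_EFinP; exact: measurable_gauss.
have fi := Radon_Nikodym_SigmaFinite.f_integrable dom.
apply: ae_eq_integral => //.
- by apply: emeasurable_funM => //; exact: measurable_int fi.
- exact: emeasurable_funM.
apply: ae_eqe_mul2l; apply: integral_ae_eq => // E _ mE.
rewrite -Radon_Nikodym_SigmaFinite.f_integral//.
by apply: eq_integral => x _; rewrite gaussE.
Qed.

Lemma lebesgue_measure_shift (m : R) (A : set RR) : measurable A ->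
  pushforward mu ((fun x => m + x)%R : RR -> RR) A = mu A.
Proof.
move=> mA; have ms : measurable_fun setT ((fun x => m + x)%R : RR -> RR).
  exact: measurable_funD.
apply/esym; apply: (lebesgue_measure_unique
  (mu := measure_function_pushforward__canonical__measure_function_Measure mu ms)) => //.
move=> _ [[a b]] /= _ <-; rewrite /pushforward.
rewrite (_ : _ @^-1` _ = `](a - m)%R, (b - m)%R]%classic).
  rewrite !lebesgue_measure_itv/= !lte_fin ltrD2r.
  by rewrite -!EFinB opprB addrA subrK.
by apply/seteqP; split=> x /=; rewrite !in_itv/= => ?; lra.
Qed.

Lemma ge0_integral_shift (m : R) (f : RR -> \bar R) : measurable_fun setT f ->
  (forall x, 0 <= f x) -> \int[mu]_x f (m + x)%R = \int[mu]_x f x.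
Proof.
move=> mf f0; have ms : measurable_fun setT ((fun x => m + x)%R : RR -> RR).
  exact: measurable_funD.
transitivity (\int[pushforward mu ((fun x => m + x)%R : RR -> RR)]_x f x).
  by rewrite (ge0_integral_pushforward ms mu)// preimage_setT.
apply: (eq_measure_integral mu (m1 :=
  measure_function_pushforward__canonical__measure_function_Measure mu ms)).
by move=> A mA _; exact: lebesgue_measure_shift.
Qed.

(** The density on [0, +oo[ of [|m + w|] with [w] standard normal, written as in [folded_gauss];
    [fold_densityE] gives the form occurring in [Q_fold]. *)
Definition fold_density (m y : R) : R := (gauss (y - m) + gauss (- y - m))%R.

Lemma fold_densityE m y : fold_density m y = (gauss (y - m) + gauss (y + m))%R.
Proof. by rewrite /fold_density -[gauss (- y - m)]gaussN opprB opprK (addrC m y). Qed.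

Lemma fold_densityN m y : fold_density (- m) y = fold_density m y.
Proof. by rewrite !fold_densityE opprK addrC. Qed.

(** After translation by [m] the Gaussian density is centred at [m]; the integral is split at 0 and
    its negative half reflected onto the positive one. *)
Lemma ge0_integral_fold (m : R) (f : RR -> \bar R) : measurable_fun setT f ->
  (forall x, 0 <= f x) ->
  \int[N01]_w f `|m + w|%R =
  \int[mu]_(y in `[0%R, +oo[) ((fold_density m y)%:E * f y).
Proof.
move=> mf f0.
have mabs : measurable_fun setT (fun x : RR => f `|x|%R).
  by apply: measurableT_comp mf _; exact: normr_measurable.
have mgs (s : R) : measurable_fun setT (fun y : RR => (gauss (y - s))%:E).
  by apply/measurable_EFinP; apply: measurableT_comp measurable_gauss _;
    exact: measurable_funB.
have mgn (s : R) : measurable_fun setT (fun y : RR => (gauss (- y - s))%:E).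
  apply/measurable_EFinP; apply: measurableT_comp measurable_gauss _.
  by apply: measurable_funB => //; exact: oppr_measurable.
rewrite ge0_integral_normal//; last first.
  by apply: (measurableT_comp mabs (g := fun x => m + x)%R); exact: measurable_funD.
pose g (y : RR) := f `|y|%R * (gauss (y - m))%:E.
have mg : measurable_fun setT g by exact: emeasurable_funM.
have g0 y : 0 <= g y by rewrite mule_ge0// lee_fin gauss_ge0.
transitivity (\int[mu]_y g y).
  rewrite -(ge0_integral_shift m mg g0).
  by apply: eq_integral => x _; rewrite /g addrC addrK addrC.
(* The reflection of [g]: its integral over the positive half-line is that of [g] over the negative
   one. *)
pose h (y : RR) := f `|y|%R * (gauss (- y - m))%:E.
have mh : measurable_fun setT h by exact: emeasurable_funM.
have h0 y : 0 <= h y by rewrite mule_ge0// lee_fin gauss_ge0.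
rewrite -(setUv `]-oo, 0%R[%classic) setCitvl ge0_integral_setU//=; last 2 first.
- exact: measurable_funTS.
- by rewrite -setCitvl disj_set2E setICr.
rewrite [X in X + _](_ : _ = \int[mu]_(y in `[0%R, +oo[) h y); last first.
  rewrite integral_itv_bndo_bndc; last exact: measurable_funTS.
  rewrite (ge0_integration_by_substitution0 mh h0).
  by apply: eq_integral => y _; rewrite /h /g normrN opprK.
rewrite -ge0_integralD//; last 2 first.
- exact: measurable_funTS.
- exact: measurable_funTS.
apply: eq_integral => y; rewrite inE/= in_itv/= andbT => y0.
rewrite /h /g ger0_norm// /fold_density addrC EFinD ge0_muleDl ?lee_fin ?gauss_ge0//.
by rewrite muleC [X in _ + X = _]muleC.
Qed.

(** The folded density is even in its mean parameter because [gauss] is even. *)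
Lemma ge0_integral_foldN (m : R) (f : RR -> \bar R) : measurable_fun setT f ->
  (forall x, 0 <= f x) ->
  \int[N01]_w f `|- m + w|%R = \int[N01]_w f `|m + w|%R.
Proof.
move=> mf f0; rewrite (ge0_integral_fold (- m) mf f0) (ge0_integral_fold m mf f0).
by apply: eq_integral => y _; rewrite fold_densityN.
Qed.

End gaussian.

(** * Both channels driven by one uniform number *)

Section channel.
Context {R : realType}.
Notation RR := (measurableTypeR R).
Notation U := (@unif R).
Notation N01 := (normal_prob (0 : R) 1).
Variables (a lambda beta p01 p11 : R).

Definition disturbance (r : RR) : RR := quantile N01 (evens r).

Lemma measurable_disturbance : measurable_fun setT disturbance.
Proof. exact: measurableT_comp (measurable_quantile _) measurable_evens. Qed.

(* Under [unif] the even digits of [r] produce the Gaussian disturbance and the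
   odd ones decide whether the transmission succeeds. *)
Definition step_orig (s : R * R) (u : bool) (r : RR) : R * R :=
  if u then
    if odds r <= s.2 then (disturbance r, p11)
    else (a * s.1 + disturbance r, p01)
  else (a * s.1 + disturbance r, belief_step p01 p11 s.2).

Definition fold (s : R * R) : R * R := (`|s.1|, s.2).

Definition step_fold (s : R * R) (u : bool) (r : RR) : R * R :=
  fold (step_orig s u r).

Lemma measurable_fold : measurable_fun setT fold.
Proof.
apply: measurable_fun_pair => //.
exact: measurableT_comp (@normr_measurable R setT) measurable_fst.
Qed.

Lemma measurable_step_orig :
  measurable_fun setT (fun p : ((R * R) * bool) * RR => step_orig p.1.1 p.1.2 p.2).
Proof.
have me : measurable_fun setT (fun p : ((R * R) * bool) * RR => p.1.1.1).
  exact: measurableT_comp measurable_fst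
    (measurableT_comp measurable_fst measurable_fst).
have mb : measurable_fun setT (fun p : ((R * R) * bool) * RR => p.1.1.2).
  exact: measurableT_comp measurable_snd
    (measurableT_comp measurable_fst measurable_fst).
have mu : measurable_fun setT (fun p : ((R * R) * bool) * RR => p.1.2).
  exact: measurableT_comp measurable_snd measurable_fst.
have mw : measurable_fun setT (fun p : ((R * R) * bool) * RR => disturbance p.2).
  exact: measurableT_comp measurable_disturbance measurable_snd.
have mo : measurable_fun setT (fun p : ((R * R) * bool) * RR => odds p.2).
  exact: measurableT_comp measurable_odds measurable_snd.
have mae : measurable_fun setT (fun p : ((R * R) * bool) * RR =>
    a * p.1.1.1 + disturbance p.2).
  by apply: measurable_funD => //; exact: measurable_funM.
rewrite /step_orig; apply: measurable_fun_ifT => //.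
  apply: measurable_fun_ifT => //; first exact: measurable_fun_ler.
    exact: measurable_fun_pair.
  exact: measurable_fun_pair.
apply: measurable_fun_pair => //; apply: measurable_funD.
  exact: measurable_funM.
by apply: measurable_funM => //; exact: measurable_funB.
Qed.

Lemma measurable_step_fold :
  measurable_fun setT (fun p : ((R * R) * bool) * RR => step_fold p.1.1 p.1.2 p.2).
Proof. exact: measurableT_comp measurable_fold measurable_step_orig. Qed.

Lemma measurable_stage_cost :
  measurable_fun setT (fun p : (R * R) * bool => stage_cost lambda p.1 p.2).
Proof.
apply: measurable_funD.
  by apply: measurable_funX; exact: measurableT_comp measurable_fst measurable_fst.
apply: measurable_funM => //.
rewrite (_ : (fun _ => _) = fun p : (R * R) * bool => if p.2 then 1 else 0 : R).
  exact: measurable_fun_ifT.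
by apply/funext => -[s []].
Qed.

Local Open Scope ereal_scope.

(** The pair of [evens] and [odds] has the product law, and the quantile function turns the first
    entry into a standard normal. The Gaussian integral is innermost, so that the uniform number
    deciding on success can be fixed. *)
Lemma ge0_integral_noise (g : RR * RR -> \bar R) : measurable_fun setT g ->
  (forall p, 0 <= g p) ->
  \int[U]_r g (disturbance r, odds r) = \int[U]_c \int[N01]_w g (w, c).
Proof.
move=> mg g0; pose k (p : RR * RR) : RR * RR := (quantile N01 p.1, p.2).
have mk : measurable_fun setT k.
  apply: measurable_fun_pair => //.
  exact: measurableT_comp (measurable_quantile _) measurable_fst.
have meo : measurable_fun setT (fun r : RR => (evens r, odds r) : RR * RR).
  by apply: measurable_fun_pair; [exact: measurable_evens|exact: measurable_odds].
have mgk : measurable_fun setT (g \o k) by exact: measurableT_comp mg mk.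
transitivity (\int[law U meo]_p (g \o k) p).
  by rewrite ge0_integral_law// => p; exact: g0.
transitivity (\int[U \x U]_p (g \o k) p).
  by apply: eq_measure_integral => C mC _; exact: evens_odds_law.
rewrite (fubini_tonelli2 (g \o k) mgk (fun p => g0 (k p))).
apply: eq_integral => c _; rewrite /fubini_G/=.
have mgc : measurable_fun setT (fun w : RR => g (w, c)).
  exact: measurableT_comp mg (pair2_measurable c).
rewrite -(ge0_integral_law U (measurable_quantile N01) mgc (fun w => g0 (w, c))).
by apply: eq_measure_integral => C mC _; exact: unif_quantile.
Qed.

Lemma integral_step_wait (f : R * R -> \bar R) s : measurable_fun setT f ->
  (forall p, 0 <= f p) ->
  \int[U]_r f (step_orig s false r) =
  \int[N01]_w f ((a * s.1 + w)%R, belief_step p01 p11 s.2).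
Proof.
move=> mf f0.
have mh : measurable_fun setT (fun p : RR * RR =>
    f ((a * s.1 + p.1)%R, belief_step p01 p11 s.2)).
  apply: (measurableT_comp mf); apply: measurable_fun_pair => //.
  exact: measurable_funD.
rewrite (ge0_integral_noise mh)//=.
by rewrite integral_cst// [X in _ * X](probability_setT U) mule1.
Qed.

(** The inner Gaussian integral is constant for [c <= s.2] and for [c > s.2], events of uniform
    probability [clamp s.2] and [1 - clamp s.2]; the clamp covers beliefs outside [0, 1]. *)
Lemma integral_step_send (f : R * R -> \bar R) s : measurable_fun setT f ->
  (forall p, 0 <= f p) ->
  \int[U]_r f (step_orig s true r) =
  (clamp s.2)%:E * \int[N01]_w f (w, p11) +
  (1 - clamp s.2)%:E * \int[N01]_w f ((a * s.1 + w)%R, p01).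
Proof.
move=> mf f0.
have mh1 : measurable_fun setT (fun w : RR => f (w, p11)).
  exact: (measurableT_comp mf (pair2_measurable _)).
have mh2 : measurable_fun setT (fun w : RR => f ((a * s.1 + w)%R, p01)).
  apply: (measurableT_comp mf); apply: measurable_fun_pair => //.
  exact: measurable_funD.
pose g (p : RR * RR) := if (p.2 <= s.2)%R then f (p.1, p11)
  else f ((a * s.1 + p.1)%R, p01).
have mg : measurable_fun setT g.
  apply: measurable_fun_ifT; first exact: measurable_fun_ler.
    exact: (measurableT_comp mh1 measurable_fst).
  exact: (measurableT_comp mh2 measurable_fst).
have g0 p : 0 <= g p by rewrite /g; case: ifP.
transitivity (\int[U]_r g (disturbance r, odds r)).
  by apply: eq_integral => r _; rewrite /step_orig /g/=; case: ifP.
rewrite (ge0_integral_noise mg g0).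
set I1 := \int[N01]_w f (w, p11).
set I2 := \int[N01]_w f ((a * s.1 + w)%R, p01).
pose G (c : RR) := \int[N01]_w g (w, c).
have mG : measurable_fun setT G.
  exact: (measurable_fun_fubini_tonelli_G (m1 := N01) g mg g0).
have mB : measurable (`]-oo, s.2]%classic : set RR) by [].
have I10 : 0 <= I1 by exact: integral_ge0.
have I20 : 0 <= I2 by exact: integral_ge0.
rewrite -[LHS]/(\int[U]_c G c).
rewrite -(setUv `]-oo, s.2]%classic) ge0_integral_setU//; last first.
- by rewrite disj_set2E setICr.
- by move=> c _; exact: integral_ge0.
- exact: measurable_funTS.
- exact: measurableC.
congr (_ + _).
  rewrite (eq_integral (cst I1)); last first.
    move=> c; rewrite inE/= in_itv/= => cs.
    by apply: eq_integral => w _; rewrite /g/= cs.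
  by rewrite integral_cst// muleC -unif_cdf.
rewrite (eq_integral (cst I2)); last first.
  move=> c; rewrite inE/= in_itv/= => /negP/negbTE cs.
  by apply: eq_integral => w _; rewrite /g/= cs.
rewrite integral_cst; last exact: measurableC.
rewrite muleC; congr (_ * _).
by have := probability_setC U mB; rewrite unif_cdf EFinB.
Qed.

(** With indicators as integrands, the integral formulas for one step thereby yield the transition
    laws. *)
Lemma prob_integral_indic d (T : measurableType d) (P : probability T R)
    d' (Y : measurableType d') (g : T -> Y) (B : set Y) :
  measurable_fun setT g -> measurable B ->
  P [set w | B (g w)] = \int[P]_w (\1_B (g w))%:E.
Proof.
move=> mg mB; have mgB : measurable [set w | B (g w)].
  by rewrite -[X in measurable X]setTI; exact: mg.
transitivity (\int[P]_w (\1_[set w | B (g w)] w)%:E).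
  by rewrite (integral_indic P measurableT mgB) setIT.
apply: eq_integral => w _; rewrite !indicE.
by congr (_%:R)%:E; apply/idP/idP; rewrite !inE.
Qed.

(** The invariant set for both problems. The sign of the error is left free: at a negative error
    [trans_fold] is still the law of [step_fold]. *)
Definition beliefs : set (R * R) := [set s | 0 <= s.2 <= 1]%R.

Lemma measurable_beliefs : measurable beliefs.
Proof.
rewrite (_ : beliefs = setT `&` snd @^-1` `[0%R, 1%R]%classic); last first.
  by rewrite setTI; apply/seteqP; split=> s /=; rewrite in_itv.
exact: measurable_snd.
Qed.

Lemma clamp_id (b : R) : (0 <= b <= 1)%R -> clamp b = b.
Proof. by move=> /andP[b0 b1]; rewrite /clamp min_l// max_r. Qed.

Lemma measurable_indicE (B : set (R * R)) : measurable B ->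
  measurable_fun setT (fun p => (\1_B p)%:E : \bar R).
Proof. by move=> mB; apply/measurable_EFinP; exact: measurable_indic. Qed.

Lemma indicE_ge0 (B : set (R * R)) p : 0 <= (\1_B p)%:E :> \bar R.
Proof. by rewrite lee_fin. Qed.

Lemma measurable_shift_pair (m b : R) :
  measurable_fun setT (fun w : RR => ((m + w)%R, b) : R * R).
Proof. by apply: measurable_fun_pair => //; exact: measurable_funD. Qed.

Lemma trans_orig_step s u (B : set (R * R)) : beliefs s -> measurable B ->
  trans_orig a p01 p11 s u B = U [set r | B (step_orig s u r)].
Proof.
move=> sb mB.
have ms : measurable_fun setT (fun r : RR => step_orig s u r).
  exact: (measurableT_comp measurable_step_orig (pair1_measurable (s, u))).
rewrite (prob_integral_indic U ms mB).
case: s sb {ms} => e b sb; case: u.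
  rewrite (integral_step_send _ (measurable_indicE mB) (indicE_ge0 B)).
  rewrite (clamp_id sb) -(prob_integral_indic N01 (measurable_shift_pair _ _) mB).
  by rewrite -(prob_integral_indic N01 (pair2_measurable _) mB).
rewrite (integral_step_wait _ (measurable_indicE mB) (indicE_ge0 B)).
by rewrite -(prob_integral_indic N01 (measurable_shift_pair _ _) mB).
Qed.

Lemma folded_gaussE (m b : R) (B : set (R * R)) : measurable B ->
  folded_gauss m b B = \int[N01]_w (\1_B (fold ((m + w)%R, b)))%:E.
Proof.
move=> mB; have mf : measurable_fun setT (fun y : RR => (\1_B (y, b))%:E : \bar R).
  exact: (measurableT_comp (measurable_indicE mB) (pair2_measurable b)).
rewrite (ge0_integral_fold m mf); last by move=> y; exact: indicE_ge0.
rewrite /folded_gauss integral_mkcondr; apply: eq_integral => y _.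
rewrite /patch indicE; case: ifPn.
  by rewrite inE/= => By; rewrite mem_set// mule1.
by rewrite notin_setE/= => By; rewrite memNset// mule0.
Qed.

Lemma trans_fold_step s u (B : set (R * R)) : beliefs s -> measurable B ->
  trans_fold a p01 p11 s u B = U [set r | B (step_fold s u r)].
Proof.
move=> sb mB.
have ms : measurable_fun setT (fun r : RR => step_fold s u r).
  exact: (measurableT_comp measurable_step_fold (pair1_measurable (s, u))).
rewrite (prob_integral_indic U ms mB) /step_fold.
have mi := measurableT_comp (measurable_indicE mB) measurable_fold.
have i0 p : 0 <= ((fun p => (\1_B p)%:E : \bar R) \o fold) p by exact: indicE_ge0.
case: s sb {ms} => e b sb; case: u.
  rewrite (integral_step_send _ mi i0) (clamp_id sb) /trans_fold !folded_gaussE//.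
  (* A successful transmission folds a Gaussian of mean 0. *)
  by congr (_ * _ + _); apply: eq_integral => w _; rewrite add0r.
by rewrite (integral_step_wait _ mi i0) /trans_fold folded_gaussE.
Qed.

(** * Comparison of the two problems *)

Hypotheses (lambda_ge0 : (0 <= lambda)%R) (beta_ge0 : (0 <= beta)%R)
  (p01_01 : (0 <= p01 <= 1)%R) (p11_01 : (0 <= p11 <= 1)%R).

Lemma belief_step_beliefs e b : beliefs (e, b) -> beliefs (e, belief_step p01 p11 b).
Proof.
rewrite /beliefs/belief_step/= => /andP[b0 b1].
by move: p01_01 p11_01 => /andP[? ?] /andP[? ?]; apply/andP; split; nra.
Qed.

Lemma step_orig_beliefs s u r : beliefs s -> beliefs (step_orig s u r).
Proof.
case: s => e b /= sb; rewrite /step_orig; case: u => /=; last exact: belief_step_beliefs.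
by case: ifP.
Qed.

Lemma stage_cost_ge0 s u : (0 <= stage_cost lambda s u)%R.
Proof. by rewrite /stage_cost addr_ge0 ?sqr_ge0// mulr_ge0. Qed.

Notation value_orig := (value step_orig (stage_cost lambda) beta).
Notation value_fold := (value step_fold (stage_cost lambda) beta).

Lemma V_origE e b : beliefs (e, b) ->
  V_orig a lambda beta p01 p11 e b = value_orig (e, b).
Proof.
apply: (optimal_value_eq measurable_step_orig measurable_stage_cost
  stage_cost_ge0 beta_ge0 measurable_beliefs) => [s u r|s u B].
  exact: step_orig_beliefs.
exact: trans_orig_step.
Qed.

Lemma V_foldE e b : beliefs (e, b) ->
  V_fold a lambda beta p01 p11 e b = value_fold (e, b).
Proof.
apply: (optimal_value_eq measurable_step_fold measurable_stage_cost
  stage_cost_ge0 beta_ge0 measurable_beliefs) => [s u r sb|s u B].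
  exact: (@step_orig_beliefs s u r sb).
exact: trans_fold_step.
Qed.

Lemma integral_fold_abs (m b : R) (f : R * R -> \bar R) : measurable_fun setT f ->
  (forall p, 0 <= f p) ->
  \int[N01]_w f (fold ((a * `|m| + w)%R, b)) = \int[N01]_w f (fold ((a * m + w)%R, b)).
Proof.
move=> mf f0; have mfb : measurable_fun setT (fun y : RR => f (y, b)).
  exact: (measurableT_comp mf (pair2_measurable b)).
have [m0|m0] := leP 0%R m; first by rewrite ger0_norm.
rewrite (ltr0_norm m0) mulrN.
exact: (ge0_integral_foldN (a * m) mfb (fun y => f0 (y, b))).
Qed.

(* The symmetry of the disturbance enters here, through [integral_fold_abs]. *)
Lemma expect_next_fold (f : R * R -> \bar R) s u : measurable_fun setT f ->
  (forall p, 0 <= f p) ->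
  expect_next step_orig (f \o fold) s u = expect_next step_fold f (fold s) u.
Proof.
move=> mf f0; rewrite /expect_next.
have mff : measurable_fun setT (f \o fold) by exact: measurableT_comp mf measurable_fold.
have ff0 p : 0 <= (f \o fold) p by exact: f0.
rewrite -[RHS]/(\int[U]_r (f \o fold) (step_orig (fold s) u r)).
case: u; last first.
  rewrite (integral_step_wait _ mff ff0) (integral_step_wait _ mff ff0)/=.
  by rewrite integral_fold_abs.
rewrite (integral_step_send _ mff ff0) (integral_step_send _ mff ff0)/=.
by rewrite integral_fold_abs.
Qed.

(** The stage cost is even in the error and [expect_next_fold] transports the expectation, so both
    action values correspond under [fold]. *)
Lemma value_iter_fold n s :
  value_iter step_orig (stage_cost lambda) beta n s =
  value_iter step_fold (stage_cost lambda) beta n (fold s).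
Proof.
elim: n s => //= n IH s.
have mv := measurable_value_iter measurable_step_fold measurable_stage_cost
  stage_cost_ge0 beta_ge0 n.
have v0 := value_iter_ge0 step_fold stage_cost_ge0 beta_ge0 n.
have q u : action_value step_orig (stage_cost lambda) beta
    (value_iter step_orig (stage_cost lambda) beta n) s u =
  action_value step_fold (stage_cost lambda) beta
    (value_iter step_fold (stage_cost lambda) beta n) (fold s) u.
  rewrite /action_value -(expect_next_fold s u mv v0); congr (_ + _ * _).
    by rewrite /stage_cost /fold/= real_normK ?num_real.
  by apply: eq_integral => r _; rewrite IH.
by rewrite /bellman !q.
Qed.

Lemma value_orig_fold s : value_orig s = value_fold (fold s).
Proof.
by rewrite /value; congr (limn _); apply/funext => n; exact: value_iter_fold.
Qed.

Let mvf := measurable_value measurable_step_fold measurable_stage_cost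
  stage_cost_ge0 beta_ge0.
Let vf0 := value_ge0 measurable_step_fold measurable_stage_cost
  stage_cost_ge0 beta_ge0.

Lemma V_orig_fold e b : beliefs (e, b) ->
  V_orig a lambda beta p01 p11 e b = V_fold a lambda beta p01 p11 `|e|%R b.
Proof. by move=> sb; rewrite V_origE// V_foldE// value_orig_fold. Qed.

(** On valid beliefs the value of the original problem depends on the error through its absolute
    value only, so the integrand is a function of [|m + w|]. *)
Lemma integral_V_orig (m b : R) : beliefs (m, b) ->
  \int[N01]_w V_orig a lambda beta p01 p11 (m + w)%R b =
  \int[lebesgue_measure]_(y in `[0%R, +oo[)
     ((fold_density m y)%:E * V_fold a lambda beta p01 p11 y b).
Proof.
move=> sb; have mfb : measurable_fun setT (fun y : RR => value_fold (y, b)).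
  exact: (measurableT_comp mvf (pair2_measurable b)).
transitivity (\int[N01]_w value_fold (`|m + w|%R, b)).
  by apply: eq_integral => w _; rewrite V_origE// value_orig_fold.
rewrite (ge0_integral_fold m mfb (fun y => vf0 (y, b))).
by apply: eq_integral => y _; rewrite V_foldE.
Qed.

Lemma fold_density_abs (e y : R) : fold_density (a * `|e|) y = fold_density (a * e) y.
Proof.
have [e0|e0] := leP 0%R e; first by rewrite ger0_norm.
by rewrite ltr0_norm// mulrN fold_densityN.
Qed.

Lemma Q_orig_fold e b u : beliefs (e, b) ->
  Q_orig a lambda beta p01 p11 e b u = Q_fold a lambda beta p01 p11 `|e|%R b u.
Proof.
move=> sb; rewrite /Q_orig /Q_fold real_normK ?num_real//.
(* [Q_fold] is evaluated at [|e|]; the evenness of the folded density in its mean replaces [a * |e|]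
   by [a * e]. *)
have dens (b' : R) : \int[lebesgue_measure]_(y in `[0%R, +oo[)
    ((gauss (y - a * `|e|) + gauss (y + a * `|e|))%:E *
       V_fold a lambda beta p01 p11 y b') =
    \int[lebesgue_measure]_(y in `[0%R, +oo[)
      ((fold_density (a * e) y)%:E * V_fold a lambda beta p01 p11 y b').
  by apply: eq_integral => y _; rewrite -fold_densityE fold_density_abs.
case: u; last first.
  congr (_ + _ * _); rewrite dens; apply: integral_V_orig.
  exact: belief_step_beliefs.
have /andP[b0 b1] := sb.
(* Nonnegativity and measurability, here and below, allow the expected mixture in [Q_orig] to be
   split into the two integrals of [Q_fold]. *)
have V0 e' b' : beliefs (e', b') -> 0 <= V_orig a lambda beta p01 p11 e' b'.
  by move=> sb'; rewrite V_origE// value_orig_fold; exact: vf0.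
have mV (m b' : R) : (0 <= b' <= 1)%R ->
    measurable_fun setT (fun w : RR => V_orig a lambda beta p01 p11 (m + w)%R b').
  move=> sb'; rewrite (_ : (fun _ => _) =
    value_fold \o fold \o (fun w : RR => ((m + w)%R, b'))).
    apply: measurableT_comp (measurable_shift_pair m b').
    exact: measurableT_comp mvf measurable_fold.
  by apply/funext => w /=; rewrite V_origE// value_orig_fold.
have mV1 : measurable_fun setT (fun w : RR => V_orig a lambda beta p01 p11 w p11).
  rewrite (_ : (fun _ => _) = fun w : RR => V_orig a lambda beta p01 p11 (0 + w)%R p11).
    exact: mV.
  by apply/funext => w; rewrite add0r.
have mV2 := mV (a * e)%R p01 p01_01.
rewrite ge0_integralD//; last 4 first.
- by move=> w _; rewrite mule_ge0 ?lee_fin//; exact: V0.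
- by apply: emeasurable_funM => //; exact: measurable_cst.
- by move=> w _; rewrite mule_ge0 ?lee_fin ?subr_ge0//; exact: V0.
- by apply: emeasurable_funM => //; exact: measurable_cst.
rewrite ge0_integralZl ?lee_fin//; last by move=> w _; exact: V0.
rewrite ge0_integralZl ?lee_fin ?subr_ge0//; last by move=> w _; exact: V0.
rewrite -addeA; congr (_ + _); rewrite !EFinM -!muleA ge0_muleDr; first last.
- by rewrite mule_ge0 ?lee_fin ?subr_ge0//; apply: integral_ge0 => w _; exact: V0.
- by rewrite mule_ge0 ?lee_fin//; apply: integral_ge0 => w _; exact: V0.
congr (_ * (_ * _) + _ * (_ * _)); last first.
  by rewrite dens (@integral_V_orig (a * e)%R p01 p01_01).
(* After a success the error is pure noise, of mean 0, where the folded density is [2 * gauss y]. *)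
transitivity (\int[N01]_w V_orig a lambda beta p01 p11 (0 + w)%R p11).
  by apply: eq_integral => w _; rewrite add0r.
rewrite (@integral_V_orig 0%R p11 p11_01); apply: eq_integral => y _.
by rewrite fold_densityE subr0 addr0 mulrDl mul1r.
Qed.

End channel.

Theorem mainTheorem4 (R : realType) (a lambda beta p01 p11 : R)
    (lambda_ge0 : 0 <= lambda)
    (beta_gt0 : 0 < beta) (beta_lt1 : beta < 1)
    (p01_gt0 : 0 < p01) (p01_le1 : p01 <= 1)
    (p11_gt0 : 0 < p11) (p11_le1 : p11 <= 1)
    (stab : a ^+ 2 * (1 - p01) < 1)
    (e b : R) (b_ge0 : 0 <= b) (b_le1 : b <= 1) :
  (forall u : bool,
     Q_orig a lambda beta p01 p11 e b u = Q_fold a lambda beta p01 p11 `|e| b u)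
  /\ V_orig a lambda beta p01 p11 e b = V_fold a lambda beta p01 p11 `|e| b.
Proof.
have p01_01 : 0 <= p01 <= 1 by rewrite ltW.
have p11_01 : 0 <= p11 <= 1 by rewrite ltW.
have sb : beliefs (e, b) by apply/andP.
have beta_ge0 := ltW beta_gt0.
by split=> [u|]; [exact: Q_orig_fold|exact: V_orig_fold].
Qed.
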